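(* Let $Q$ be a Dynkin quiver with $n$ vertices. The geometric realization of the cluster tilting complex $\mathcal{T}(Q)$ is homeomorphic to the $(n-1)$-sphere. Furthermore, a homeomorphism $\lambda:|\mathcal{T}(Q)|\to S^{n-1}$ is given by $$\lambda\Big(\sum t_j\beta_j+\sum t_ip(v_i)[1]\Big)=\frac{\sum t_j\beta_j-\sum t_ip(v_i)}{\big\|\sum t_j\beta_j-\sum t_ip(v_i)\big\|}.$$
   Context: A Dynkin quiver is a quiver whose underlying graph is a simply laced Dynkin diagram (with any orientation). $\Bbbk$ is an algebraically closed field; representations are finite dimensional over $\Bbbk$; $S^{n-1}$ is the unit sphere in $\mathbb{R}^n$. $P(v)$ is the indecomposable projective representation at $v$, $p(v)=\underline{\dim}\,P(v)$, and $p(v)[1]$ denotes a formal ''shifted indecomposable projective root''. $\Phi_+$ is the set of positive roots; for Dynkin $Q$ it equals the set of Schur roots (vectors $\beta\in\mathbb N^n$ whose general representation is indecomposable). $\mathrm{ext}_Q(\alpha,\beta)$ is the minimum of $\dim\mathrm{Ext}^1_Q(A,B)$ over representations $A,B$ with $\underline{\dim}A=\alpha$, $\underline{\dim}B=\beta$. A partial virtual semi-tilting set is a collection of distinct elements $\{\beta_1,\dots,\beta_k,p(v_{k+1})[1],\dots,p(v_m)[1]\}$ of Schur roots $\beta_j$ and shifted indecomposable projective roots $p(v_i)[1]$ with $\mathrm{ext}_Q(\beta_i,\beta_j)=0$ for $i\ne j$ and $(\beta_j)_{v_i}=0$ for all $i,j$. The cluster tilting complex $\mathcal{T}(Q)$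 is the finite simplicial complex with vertex set $\Phi_+\cup\{p(v)[1]\}_{v\in Q_0}$ whose simplices are the nonempty partial virtual semi-tilting sets. Points of $|\mathcal{T}(Q)|$ are formal convex combinations $\sum t_j\beta_j+\sum t_ip(v_i)[1]$ ($t\ge0$, $\sum t=1$) of the vertices of a simplex, with the usual Euclidean topology. *)

(* Defs.v *)
From HB Require Import structures.
From mathcomp Require Import all_boot all_order all_algebra.
From mathcomp Require Import all_classical all_reals all_analysis.
(* Not imported: its notations clash with those of MathComp-Analysis. *)
From mathcomp Require mpoly.
Import Order.TTheory GRing.Theory Num.Theory.
Import numFieldNormedType.Exports.

Set Implicit Arguments.
Unset Strict Implicit.
Unset Printing Implicit Defensive.

Local Open Scope classical_set_scope.
Local Open Scope ring_scope.

(** * Quivers *)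

Record quiver (n : nat) := Quiver {
  arrow : finType;
  src : arrow -> 'I_n;
  tgt : arrow -> 'I_n }.

Inductive dynkin_type := DynkinA | DynkinD | DynkinE.

Definition dynkin_rank (X : dynkin_type) (n : nat) : bool :=
  match X with
  | DynkinA => (1 <= n)%N
  | DynkinD => (4 <= n)%N
  | DynkinE => (6 <= n <= 8)%N
  end.

(* Chain 0 - 1 - ... - (n-2), with the extra vertex n-1 joined to vertex c. *)
Definition branched_edge (n c : nat) (i j : nat) : bool :=
  ((i.+1 == j) && (j < n.-1)%N) || ((i == c) && (j == n.-1)).

(* One orientation of each edge of the diagram with n vertices; E_6, E_7, E_8
   are the diagrams of type DynkinE with n = 6, 7, 8. *)
Definition dynkin_edge (X : dynkin_type) (n : nat) (i j : nat) : bool :=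
  match X with
  | DynkinA => i.+1 == j
  | DynkinD => branched_edge n 1 i j
  | DynkinE => branched_edge n 2 i j
  end.

(* The underlying multigraph (loops and multiple edges are excluded by the
   edge count) is a simply laced Dynkin diagram, up to relabelling vertices. *)
Definition dynkin_quiver (n : nat) (Q : quiver n) : Prop :=
  exists (X : dynkin_type) (sigma : 'I_n -> 'I_n),
    [/\ dynkin_rank X n, bijective sigma &
    forall i j : 'I_n,
      #|[pred a : arrow Q | ((src a == i) && (tgt a == j))
                         || ((src a == j) && (tgt a == i))]| =
      (dynkin_edge X n (sigma i) (sigma j)
       || dynkin_edge X n (sigma j) (sigma i) : nat)].

(** * Representations *)

(* A representation up to the choice of a basis of each V_v: it is k^(rdim v)
   at v, linear maps being matrices acting on row vectors on the right. *)
Record representation (n : nat) (k : fieldType) (Q : quiver n) := Rep {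
  rdim : 'I_n -> nat;
  rmap : forall a : arrow Q, 'M[k]_(rdim (src a), rdim (tgt a)) }.

Notation dimvector n := {ffun 'I_n -> nat}.

Definition dimvec (n : nat) (k : fieldType) (Q : quiver n)
  (V : representation k Q) : dimvector n := [ffun v => rdim V v].

Definition rep_morph (n : nat) (k : fieldType) (Q : quiver n)
  (V W : representation k Q) (g : forall v, 'M[k]_(rdim V v, rdim W v)) : Prop :=
  forall a : arrow Q, rmap V a *m g (tgt a) = g (src a) *m rmap W a.

Definition rep_iso (n : nat) (k : fieldType) (Q : quiver n)
  (V W : representation k Q) : Prop :=
  exists (g : forall v, 'M[k]_(rdim V v, rdim W v))
         (h : forall v, 'M[k]_(rdim W v, rdim V v)),
    [/\ rep_morph g, rep_morph h,
        forall v, g v *m h v = 1%:M & forall v, h v *m g v = 1%:M].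

Definition rep_sum (n : nat) (k : fieldType) (Q : quiver n)
  (V W : representation k Q) : representation k Q :=
  Rep (rdim := fun v => (rdim V v + rdim W v)%N)
      (fun a => block_mx (rmap V a) 0 0 (rmap W a)).

Definition rep_nonzero (n : nat) (k : fieldType) (Q : quiver n)
  (V : representation k Q) : Prop := exists v, rdim V v != 0%N.

Definition rep_indecomposable (n : nat) (k : fieldType) (Q : quiver n)
  (V : representation k Q) : Prop :=
  rep_nonzero V /\
  forall W1 W2 : representation k Q,
    rep_iso V (rep_sum W1 W2) -> ~ (rep_nonzero W1 /\ rep_nonzero W2).

(** * General representations and Schur roots *)

Notation rep_coord Q alpha :=
  {a : arrow Q & 'I_(alpha (src a)) * 'I_(alpha (tgt a))}%type.

(* The affine space of representations of dimension vector alpha. *)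
Notation rep_space k Q alpha := {ffun rep_coord Q alpha -> k}.

Definition rep_of (n : nat) (k : fieldType) (Q : quiver n)
  (alpha : dimvector n) (x : rep_space k Q alpha) : representation k Q :=
  Rep (rdim := alpha)
      (fun a => \matrix_(i, j)
         x (Tagged (fun a => 'I_(alpha (src a)) * 'I_(alpha (tgt a)))%type
                   (i, j))).

Definition zariski_closed (k : fieldType) (I : finType)
  (Z : set {ffun I -> k}) : Prop :=
  exists S : set (mpoly.mpoly #|I| k),
    Z = [set x | forall p, S p ->
                   mpoly.meval (fun i : 'I_#|I| => x (enum_val i)) p = 0].

Definition zariski_open (k : fieldType) (I : finType)
  (U : set {ffun I -> k}) : Prop := zariski_closed (~` U).

Definition schur_root (n : nat) (k : fieldType) (Q : quiver n)
  (beta : dimvector n) : Prop :=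
  exists U : set (rep_space k Q beta),
    [/\ zariski_open U, U !=set0 &
        forall x, U x -> rep_indecomposable (rep_of x)].

(** * Ext^1 *)

Section Ext.
Variables (n : nat) (k : fieldType) (Q : quiver n) (A B : representation k Q).

(* Families of linear maps A_v -> B_v, stored by matrix coefficients. *)
Definition cochain0 :=
  {ffun {v : 'I_n & 'I_(rdim A v) * 'I_(rdim B v)}%type -> k^o}.

(* Families of linear maps A_(src a) -> B_(tgt a). *)
Definition cochain1 :=
  {ffun {a : arrow Q & 'I_(rdim A (src a)) * 'I_(rdim B (tgt a))}%type -> k^o}.

Definition cochain0_mx (h : cochain0) (v : 'I_n) : 'M[k]_(rdim A v, rdim B v) :=
  \matrix_(i, j)
    h (Tagged (fun v => 'I_(rdim A v) * 'I_(rdim B v))%type (i, j)).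

Definition cochain1_mx (z : cochain1) (a : arrow Q) :
    'M[k]_(rdim A (src a), rdim B (tgt a)) :=
  \matrix_(i, j)
    z (Tagged (fun a => 'I_(rdim A (src a)) * 'I_(rdim B (tgt a)))%type (i, j)).

Definition ext_diff (h : cochain0) : cochain1 :=
  [ffun c => (rmap A (tag c) *m cochain0_mx h (tgt (tag c))
              - cochain0_mx h (src (tag c)) *m rmap B (tag c))
             (tagged c).1 (tagged c).2].

Lemma ext_diff_mx h a : cochain1_mx (ext_diff h) a =
  rmap A a *m cochain0_mx h (tgt a) - cochain0_mx h (src a) *m rmap B a.
Proof. by apply/matrixP => i j; rewrite !mxE ffunE /= !mxE. Qed.

Lemma cochain0_mxP (g : forall v, 'M[k]_(rdim A v, rdim B v)) :
  exists h, forall v, cochain0_mx h v = g v.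
Proof.
exists [ffun c => g (tag c) (tagged c).1 (tagged c).2] => v.
by apply/matrixP => i j; rewrite !mxE ffunE.
Qed.

Lemma cochain1_mxP (g : forall a : arrow Q, 'M[k]_(rdim A (src a), rdim B (tgt a))) :
  exists z, forall a, cochain1_mx z a = g a.
Proof.
exists [ffun c => g (tag c) (tagged c).1 (tagged c).2] => a.
by apply/matrixP => i j; rewrite !mxE ffunE.
Qed.

Lemma cochain1_mx_inj (z z' : cochain1) :
  (forall a, cochain1_mx z a = cochain1_mx z' a) -> z = z'.
Proof.
move=> e; apply/ffunP => -[a [i j]].
by have /matrixP/(_ i j) := e a; rewrite !mxE.
Qed.

Fact ext_diff_linear : linear ext_diff.
Proof.
move=> c g h; apply: cochain1_mx_inj => a.
have cl v : cochain0_mx (c *: g + h) v = c *: cochain0_mx g v + cochain0_mx h v.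
  by apply/matrixP => i j; rewrite !mxE !ffunE.
have cl1 (x y : cochain1) :
    cochain1_mx (c *: x + y) a = c *: cochain1_mx x a + cochain1_mx y a.
  by apply/matrixP => i j; rewrite !mxE !ffunE.
rewrite cl1 !ext_diff_mx !cl mulmxDr mulmxDl -scalemxAr -scalemxAl.
by rewrite opprD addrACA scalerBr.
Qed.

HB.instance Definition _ :=
  GRing.isLinear.Build k cochain0 cochain1 *:%R ext_diff ext_diff_linear.

(* Ext^1(A, B), computed from the standard projective resolution of A, is the
   cokernel of
     prod_v Hom(A_v, B_v) -> prod_a Hom(A_(src a), B_(tgt a)),
     h |-> (h_(tgt a) o A_a - B_a o h_(src a))_a;
   [ext_cocycle_equivP] and [ext_extensionP] below identify it with the set of
   equivalence classes of extensions 0 -> B -> E -> A -> 0. *)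
Definition dim_ext : nat :=
  (\dim (fullv : {vspace cochain1}) - \dim (limg (linfun ext_diff)))%N.

Definition ext_cocycle (z : cochain1) : representation k Q :=
  Rep (rdim := fun v => (rdim B v + rdim A v)%N)
      (fun a => block_mx (rmap B a) 0 (cochain1_mx z a) (rmap A a)).

Lemma ext_cocycle_equivP (z z' : cochain1) :
  (exists g : forall v, 'M[k]_(rdim A v, rdim B v),
     @rep_morph n k Q (ext_cocycle z) (ext_cocycle z')
              (fun v => block_mx 1%:M 0 (g v) 1%:M))
  <-> z - z' \in limg (linfun ext_diff).
Proof.
have subE (x y : cochain1) a :
    cochain1_mx (x - y) a = cochain1_mx x a - cochain1_mx y a.
  by apply/matrixP => i j; rewrite !mxE !ffunE.
split=> [[g gm]|/memv_imgP[h _ ]].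
  have [h hE] := cochain0_mxP (fun v => - g v).
  apply/memv_imgP; exists h; first exact: memvf.
  rewrite lfunE /=; apply: cochain1_mx_inj => a.
  have := gm a; rewrite /= !mulmx_block !(mulmx0, mul0mx, mulmx1, mul1mx, addr0, add0r).
  case/eq_block_mx => _ _ e _; rewrite ext_diff_mx subE !hE mulmxN mulNmx opprK.
  by rewrite [RHS]addrC; apply/eqP; rewrite subr_eq addrAC -e addrK.
rewrite lfunE /= => e.
exists (fun v => - cochain0_mx h v) => a.
have := subE z z' a; rewrite e ext_diff_mx => /eqP.
rewrite /= !mulmx_block !(mulmx0, mul0mx, mulmx1, mul1mx, addr0, add0r).
rewrite mulmxN mulNmx eq_sym subr_eq => /eqP ->; congr block_mx.
by rewrite addrAC (addrC (rmap A a *m _)) addrK.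
Qed.

Lemma ext_extensionP (E : representation k Q)
  (i : forall v, 'M[k]_(rdim B v, rdim E v))
  (p : forall v, 'M[k]_(rdim E v, rdim A v)) :
  rep_morph i -> rep_morph p ->
  (forall v, [/\ row_free (i v), row_full (p v) & (i v == kermx (p v))%MS]) ->
  exists (z : cochain1) (s : forall v, 'M[k]_(rdim A v, rdim E v)),
    [/\ @rep_morph n k Q (ext_cocycle z) E (fun v => col_mx (i v) (s v)),
        forall v, row_free (col_mx (i v) (s v)),
        forall v, row_full (col_mx (i v) (s v)) &
        forall v, col_mx (i v) (s v) *m p v = col_mx 0 1%:M].
Proof.
move=> im pm ex; pose s v := pinvmx (p v).
have sp v : s v *m p v = 1%:M.
  by have [_ pf _] := ex v; rewrite /s mulVpmx.
clearbody s.
have ip v : i v *m p v = 0.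
  by have [_ _ /andP[/sub_kermxP]] := ex v.
have kp v m (x : 'M[k]_(m, rdim E v)) : x *m p v = 0 -> (x <= i v)%MS.
  move=> /sub_kermxP xk; have [_ _ /andP[_ ki]] := ex v.
  exact: submx_trans ki.
pose d a := s (src a) *m rmap E a - rmap A a *m s (tgt a).
have dp a : d a *m p (tgt a) = 0.
  by rewrite /d mulmxBl -!mulmxA pm sp mulmx1 mulmxA sp mul1mx subrr.
have [z zE] := cochain1_mxP (fun a => d a *m pinvmx (i (tgt a))).
exists z, s; split=> [a|v|v|v].
- rewrite /= mul_block_col mul_col_mx zE mul0mx addr0 im.
  by rewrite mulmxKpV ?kp // /d subrK.
- rewrite -kermx_eq0; apply/eqP/row_matrixP => r; rewrite row0.
  set w := row r _.
  have : w *m col_mx (i v) (s v) = 0 by rewrite /w -row_mul mulmx_ker row0.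
  rewrite -[w]hsubmxK mul_row_col => e.
  have e2 : rsubmx w = 0.
    have := congr1 (mulmx^~ (p v)) e.
    by rewrite mulmxDl -!mulmxA ip sp mulmx0 add0r mulmx1 mul0mx.
  move: e; rewrite e2 mul0mx addr0 => e1.
  have [fi _ _] := ex v.
  have -> : lsubmx w = 0 by apply: (row_free_inj fi); rewrite mul0mx.
  by rewrite row_mx0.
- rewrite -sub1mx -addsmxE.
  have -> : 1%:M = (1%:M - p v *m s v) + p v *m s v :> 'M[k]_(rdim E v).
    by rewrite subrK.
  apply: addmx_sub_adds; last exact: submxMl.
  by apply: kp; rewrite mulmxBl mul1mx -mulmxA sp mulmx1 subrr.
- by rewrite mul_col_mx ip sp.
Qed.

End Ext.

Section MinExt.
Variables (n : nat) (k : fieldType) (Q : quiver n).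

Definition ext_value (alpha beta : dimvector n) (e : nat) : Prop :=
  exists A B : representation k Q,
    [/\ dimvec A = alpha, dimvec B = beta & dim_ext A B = e].

Fact ext_value_ex alpha beta : exists e, `[< ext_value alpha beta e >].
Proof.
pose V (d : dimvector n) := Rep (rdim := d) (fun a : arrow Q => 0 : 'M[k]__).
exists (dim_ext (V alpha) (V beta)); apply/asboolP.
by exists (V alpha), (V beta); split=> //; apply/ffunP => v; rewrite ffunE.
Qed.

Definition ext_dim (alpha beta : dimvector n) : nat :=
  ex_minn (ext_value_ex alpha beta).

End MinExt.

(** * Indecomposable projectives *)

Fixpoint is_path (n : nat) (Q : quiver n) (v w : 'I_n) (s : seq (arrow Q)) : bool :=
  if s is a :: s' then (src a == v) && is_path (tgt a) w s' else v == w.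

(* The paths from v to w, including the trivial one when v = w. The length
   bound n only serves to get a finite type: in a quiver without oriented
   cycles a path visits no vertex twice, so it has length less than n. *)
Definition quiver_path (n : nat) (Q : quiver n) (v w : 'I_n) : finType :=
  {s : n.-bseq (arrow Q) | is_path v w s}.

(* P(v)_w has the paths from v to w as a basis, and an arrow a : w -> w' maps
   a path s to the path "s followed by a". *)
Definition projective (n : nat) (k : fieldType) (Q : quiver n) (v : 'I_n) :
    representation k Q :=
  Rep (rdim := fun w => #|quiver_path Q v w|)
      (fun a => \matrix_(i, j)
         ((val (val (enum_val j)) == rcons (val (val (enum_val i))) a)%:R)).

Definition projective_root (n : nat) (k : fieldType) (Q : quiver n) (v : 'I_n) :
  dimvector n := dimvec (projective k Q v).

(** * The cluster tilting complex *)

(* [Root beta] stands for beta and [ShiftedProj v] for p(v)[1]. *)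
Notation cluster_vertex n := (dimvector n + 'I_n)%type.
Notation Root beta := (inl beta).
Notation ShiftedProj v := (inr v).

Definition partial_virtual_semi_tilting (n : nat) (k : fieldType) (Q : quiver n)
  (s : set (cluster_vertex n)) : Prop :=
  [/\ finite_set s,
      forall beta, s (Root beta) -> schur_root k Q beta,
      forall beta beta', s (Root beta) -> s (Root beta') -> beta <> beta' ->
        ext_dim k Q beta beta' = 0%N &
      forall beta v, s (Root beta) -> s (ShiftedProj v) -> beta v = 0%N].

(* A simplicial complex is given by the set of its (nonempty) simplices. *)
Definition cluster_tilting_complex (n : nat) (k : fieldType) (Q : quiver n) :
    set (set (cluster_vertex n)) :=
  [set s | s !=set0 /\ partial_virtual_semi_tilting k Q s].

(* A point is its family of barycentric coordinates. For a complex with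
   finitely many vertices the topology of pointwise convergence on these
   families is the usual Euclidean one. *)
Definition realization (R : realType) (X : choiceType) (K : set (set X)) :
    set {ptws X -> R} :=
  [set t | exists2 s, K s &
     [/\ forall x, ~ s x -> t x = 0, forall x, 0 <= t x &
         \sum_(x \in s) t x = 1]].

Arguments realization R {X} K.

(* The norm provided by the library on row vectors is the sup norm, which
   induces the same topology. *)
Definition euclidean_norm (R : realType) (n : nat) (x : 'rV[R]_n) : R :=
  Num.sqrt (\sum_i x 0 i ^+ 2).

Definition unit_sphere (R : realType) (n : nat) : set 'rV[R]_n :=
  [set x | euclidean_norm x = 1].

Arguments unit_sphere R n : clear implicits.

Definition dimvector_row (R : realType) (n : nat) (alpha : dimvector n) : 'rV[R]_n :=
  \row_i (alpha i)%:R.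

Definition vertex_vector (R : realType) (n : nat) (k : fieldType) (Q : quiver n)
  (x : cluster_vertex n) : 'rV[R]_n :=
  match x with
  | Root beta => dimvector_row R beta
  | ShiftedProj v => - dimvector_row R (projective_root k Q v)
  end.

Definition cluster_lambda (R : realType) (n : nat) (k : fieldType) (Q : quiver n)
  (t : {ptws cluster_vertex n -> R}) : 'rV[R]_n :=
  let y := \sum_(x \in [set: cluster_vertex n]) t x *: vertex_vector R k Q x in
  (euclidean_norm y)^-1 *: y.

Arguments cluster_lambda R {n} k Q t.

(** * Homeomorphisms between subspaces *)

Definition homeomorphism (X Y : topologicalType) (A : set X) (B : set Y)
  (f : X -> Y) : Prop :=
  [/\ set_bij A B f, {within A, continuous f} &
      exists g : Y -> X,
        {in A, cancel f g} /\ {within B, continuous g}].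

Definition homeomorphic (X Y : topologicalType) (A : set X) (B : set Y) : Prop :=
  exists f : X -> Y, homeomorphism A B f.

(* Main.v *)
From HB Require Import structures.
Require Import Defs.
From mathcomp Require Import all_boot all_order all_algebra.
From mathcomp Require Import all_classical all_reals all_analysis.
From mathcomp Require mpoly.
Import (canonicals) mpoly.
From mathcomp Require Import ring lra zify.
Import Order.TTheory GRing.Theory Num.Theory.
Import numFieldNormedType.Exports.

Local Open Scope classical_set_scope.
Local Open Scope ring_scope.

(** Send a vertex beta of the complex to the vector beta and a vertex p(v)[1] to
    -p(v). The theorem says that every real vector is a positive combination of
    the images of the vertices of exactly one partial virtual semi-tilting set,
    with unique coefficients; lambda is then the radial projection of the complex
    to the sphere. Since the realization is compact
    and the sphere is Hausdorff, it is enough that lambda is a continuous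
    bijection ([compact_homeomorphism]), and since rational directions are dense
    and the image of lambda is closed, surjectivity only has to be checked on
    integral vectors.

    The shifted projectives separate from the roots. As the Tits form is positive
    definite, Q has no oriented cycle, so the matrix of the numbers p(v)_w is
    unitriangular for a suitable order of the vertices. The compatibility
    condition between beta and p(v)[1] says that the roots used have a sum d with
    d_v = 0 as soon as p(v)[1] occurs; thus a point of a cone is a solution of the
    linear complementarity problem y = d - sum m_v p(v), d, m >= 0, d_v m_v = 0,
    which has exactly one solution, found vertex by vertex
    ([complementary_unique], [complementary_exists]). What remains is to write a
    nonnegative vector d in a unique way as a positive combination of pairwise
    Ext-orthogonal Schur roots.

    For integral d, existence means that d is the dimension vector of a
    representation M with Ext(M, M) = 0: its indecomposable summands give the
    decomposition ([canonical_decomposition_exists]). Such an M exists because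
    an indecomposable representation of a quiver with positive definite Tits
    form is a brick (Ringel's lemma, [indecomposable_brick]), hence rigid, and
    because a representation with dim Hom(M, M) minimal has no extensions between
    complementary summands ([hom_minimal_ext]): its endomorphisms extend along
    every deformation.

    For uniqueness, subtract two decompositions of the same real vector. If they
    differ, the positive and the negative part of the difference are decompositions
    of one vector without a common root, and as the equations are rational
    there are integral ones with the same supports ([integral_signs]). The two
    direct sums of bricks are rigid with the same dimension vector, hence
    isomorphic ([rigid_iso]), and a brick which is a summand of a direct sum is a
    summand of one of the terms ([canonical_decomposition_unique]).

    General representations are handled without dimension counts. If
    Ext(M, M) = 0, an explicit polynomial F with F(M) <> 0 is such that
    F(X) <> 0 forces X to be isomorphic to M ([rigid_iso_open]): the identity of
    M extends to a polynomial family of morphisms M -> X because the obstruction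
    lies in Ext(M, X), which vanishes near M. This relates the Schur roots and
    the generic ext of the definitions to rigid representations
    ([schur_rootP], [rigid_ext_vanishes]). *)

Set Implicit Arguments.
Unset Strict Implicit.
Unset Printing Implicit Defensive.

(** * Morphisms, summands and subrepresentations *)
Section Morphisms.

Variables (n : nat) (k : fieldType) (Q : quiver n).
Local Notation rep := (representation k Q).
Local Notation fam A B := (forall v, 'M[k]_(rdim A v, rdim B v)).
Implicit Types A B C M N X Y : rep.

Definition comp_fam A B C (f : fam A B) (g : fam B C) : fam A C :=
  fun v => f v *m g v.

Lemma rep_morph_comp A B C (f : fam A B) (g : fam B C) :
  rep_morph f -> rep_morph g -> rep_morph (comp_fam f g).
Proof. by move=> fm gm a; rewrite /comp_fam mulmxA fm -mulmxA gm mulmxA. Qed.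

Lemma rep_morph_id A : @rep_morph n k Q A A (fun v => 1%:M).
Proof. by move=> a; rewrite mulmx1 mul1mx. Qed.

Lemma rep_morph_inverse M N (f : fam M N) (g : fam N M) : rep_morph f ->
  (forall v, f v *m g v = 1%:M) -> (forall v, g v *m f v = 1%:M) -> rep_morph g.
Proof.
move=> fm fg gf a.
rewrite -[LHS]mul1mx -gf -mulmxA (mulmxA (f _)) -fm -!mulmxA fg mulmx1.
by [].
Qed.

Definition total_dim A := (\sum_v rdim A v)%N.

Lemma rep_nonzeroP A : rep_nonzero A <-> (0 < total_dim A)%N.
Proof.
rewrite lt0n sum_nat_eq0 negb_forall; split=> [[v v0]|/existsP[v v0]].
  by apply/existsP; exists v.
by exists v.
Qed.

Lemma rep_iso_sym A B : rep_iso A B -> rep_iso B A.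
Proof. by case=> g [h [? ? ? ?]]; exists h, g. Qed.

Lemma rep_iso_trans A B C : rep_iso A B -> rep_iso B C -> rep_iso A C.
Proof.
move=> [g [h [gm hm gh hg]]] [g' [h' [gm' hm' gh' hg']]].
exists (comp_fam g g'), (comp_fam h' h).
split; try exact: rep_morph_comp.
- by move=> v; rewrite /comp_fam mulmxA -(mulmxA (g v)) gh' mulmx1 gh.
- by move=> v; rewrite /comp_fam mulmxA -(mulmxA (h' v)) hg mulmx1 hg'.
Qed.

Lemma rep_iso_dim A B v : rep_iso A B -> rdim A v = rdim B v.
Proof.
case=> g [h [_ _ gh hg]]; apply/eqP; rewrite eqn_leq.
have := mxrankM_maxr (g v) (h v); rewrite gh mxrank1 => /leq_trans ->; last first.
  exact: rank_leq_row.
have := mxrankM_maxr (h v) (g v); rewrite hg mxrank1 => /leq_trans -> //.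
exact: rank_leq_row.
Qed.

Definition summand A B : Prop :=
  exists (i : fam A B) (p : fam B A),
    [/\ rep_morph i, rep_morph p & forall v, i v *m p v = 1%:M].

Lemma rep_iso_summand A B : rep_iso A B -> summand A B.
Proof. by case=> g [h [? ? ? ?]]; exists g, h. Qed.

Lemma summand_trans A B C : summand A B -> summand B C -> summand A C.
Proof.
move=> [i [p [im pm ip]]] [i' [p' [im' pm' ip']]].
exists (comp_fam i i'), (comp_fam p' p); split; try exact: rep_morph_comp.
by move=> v; rewrite /comp_fam mulmxA -(mulmxA (i v)) ip' mulmx1 ip.
Qed.

Lemma summand_dim A B v : summand A B -> (rdim A v <= rdim B v)%N.
Proof.
case=> i [p [_ _ ip]]; have := mxrankM_maxr (i v) (p v).
by rewrite ip mxrank1 => /leq_trans -> //; exact: rank_leq_row.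
Qed.

Lemma rep_sum_biproduct A B :
  exists (i1 : fam A (rep_sum A B)) (i2 : fam B (rep_sum A B))
         (p1 : fam (rep_sum A B) A) (p2 : fam (rep_sum A B) B),
  [/\ rep_morph i1, rep_morph i2, rep_morph p1 & rep_morph p2] /\
  [/\ forall v, i1 v *m p1 v = 1%:M, forall v, i2 v *m p2 v = 1%:M,
      forall v, i1 v *m p2 v = 0, forall v, i2 v *m p1 v = 0 &
      forall v, p1 v *m i1 v + p2 v *m i2 v = 1%:M].
Proof.
exists (fun v => row_mx 1%:M 0), (fun v => row_mx 0 1%:M),
  (fun v => col_mx 1%:M 0), (fun v => col_mx 0 1%:M).
split; split.
- by move=> a; rewrite /= mul_mx_row mul_row_block !(mulmx0,mul0mx,mulmx1,mul1mx,addr0,add0r).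
- by move=> a; rewrite /= mul_mx_row mul_row_block !(mulmx0,mul0mx,mulmx1,mul1mx,addr0,add0r).
- by move=> a; rewrite /= mul_block_col mul_col_mx !(mulmx0,mul0mx,mulmx1,mul1mx,addr0,add0r).
- by move=> a; rewrite /= mul_block_col mul_col_mx !(mulmx0,mul0mx,mulmx1,mul1mx,addr0,add0r).
- by move=> v; rewrite mul_row_col !(mulmx0,mul0mx,mulmx1,mul1mx,addr0,add0r).
- by move=> v; rewrite mul_row_col !(mulmx0,mul0mx,mulmx1,mul1mx,addr0,add0r).
- by move=> v; rewrite mul_row_col !(mulmx0,mul0mx,mulmx1,mul1mx,addr0,add0r).
- by move=> v; rewrite mul_row_col !(mulmx0,mul0mx,mulmx1,mul1mx,addr0,add0r).
- move=> v; rewrite !mul_col_row !(mulmx0,mul0mx,mulmx1,mul1mx,addr0,add0r).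
  by rewrite add_block_mx !(addr0, add0r) -scalar_mx_block.
Qed.

Lemma summand_suml A B : summand A (rep_sum A B).
Proof.
by have [i1 [i2 [p1 [p2 [[? ? ? ?] [? ? ? ? ?]]]]]] := rep_sum_biproduct A B; exists i1, p1.
Qed.

Lemma summand_sumr A B : summand B (rep_sum A B).
Proof.
by have [i1 [i2 [p1 [p2 [[? ? ? ?] [? ? ? ? ?]]]]]] := rep_sum_biproduct A B; exists i2, p2.
Qed.

(** A subrepresentation is given by spanning families of rows stable under the
    arrows. *)
Lemma rep_sub_exists X (d : 'I_n -> nat) (U : forall v, 'M[k]_(d v, rdim X v)) :
  (forall a : arrow Q, (U (src a) *m rmap X a <= U (tgt a))%MS) ->
  exists (S : rep) (kappa : fam S X),
    [/\ rep_morph kappa, forall v, row_free (kappa v) &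
        forall v, (kappa v == U v)%MS].
Proof.
move=> Us; pose s v := row_base (U v).
exists (Rep (rdim := fun v => \rank (U v))
   (fun a => s (src a) *m rmap X a *m pinvmx (s (tgt a)))), s; split.
- move=> a /=; rewrite mulmxKpV // eq_row_base.
  by apply: submx_trans (Us a); rewrite submxMr // eq_row_base.
- by move=> v; exact: row_base_free.
- by move=> v; exact/eqmxP/eq_row_base.
Qed.

Lemma row_free_cancel m1 m2 m3 (x y : 'M[k]_(m1, m2)) (u : 'M[k]_(m2, m3)) :
  row_free u -> x *m u = y *m u -> x = y.
Proof. by move=> uf; exact: row_free_inj. Qed.

Lemma rep_morph_mono A B C (f : fam A B) (g : fam B C) :
  rep_morph g -> (forall v, row_free (g v)) -> rep_morph (comp_fam f g) ->
  rep_morph f.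
Proof.
move=> gm gf fgm a; apply: (row_free_cancel (gf (tgt a))).
by rewrite -mulmxA fgm -[RHS]mulmxA gm mulmxA.
Qed.

(** The last clause is the universal property, for a single vertex and for any
    number of row vectors at once. *)
Lemma rep_ker X Y (p : fam X Y) : rep_morph p ->
  exists (K : rep) (kappa : fam K X),
    [/\ rep_morph kappa, forall v, row_free (kappa v),
        forall v, kappa v *m p v = 0 &
        forall v m (x : 'M[k]_(m, rdim X v)), x *m p v = 0 ->
          exists y, x = y *m kappa v].
Proof.
move=> pm; have [a|K [kappa [km kf ke]]] := @rep_sub_exists X (rdim X) (fun v => kermx (p v)).
  by apply/sub_kermxP; rewrite -mulmxA pm mulmxA mulmx_ker mul0mx.
exists K, kappa; split=> // v.
  by apply/sub_kermxP; have /andP[] := ke v.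
move=> m x /sub_kermxP xk; have /andP[_ kk] := ke v.
exact/submxP/(submx_trans xk).
Qed.

Lemma rep_image X Y (f : fam X Y) : rep_morph f ->
  exists (I : rep) (pr : fam X I) (iota : fam I Y) (s : fam I X),
    [/\ rep_morph pr, rep_morph iota, forall v, f v = pr v *m iota v &
        forall v, row_free (iota v) /\ s v *m pr v = 1%:M] /\
    forall v, rdim I v = \rank (f v).
Proof.
move=> fm; have [a|I [iota [im jf ie]]] := @rep_sub_exists Y (rdim X) f.
  by rewrite -fm submxMl.
pose pr v : 'M[k]_(rdim X v, rdim I v) := f v *m pinvmx (iota v).
have fE v : f v = pr v *m iota v.
  by rewrite mulmxKpV //; have /andP[] := ie v.
have rk v : rdim I v = \rank (f v).
  by rewrite -(eqmxP (ie v)); apply/esym/eqP/jf.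
have pf v : row_full (pr v).
  rewrite /row_full eqn_leq rank_leq_col /=.
  by apply: leq_trans (mxrankM_maxl (pr v) (iota v)); rewrite -fE rk.
have pm : rep_morph pr.
  apply: (rep_morph_mono im jf) => a; rewrite /comp_fam -!fE; exact: fm.
exists I, pr, iota, (fun v => pinvmx (pr v)); do 2! split => //.
by split=> //; exact: mulVpmx.
Qed.

(** Idempotents split: the kernel of the retraction is a complement. *)
Lemma summand_complement A B : summand A B ->
  exists C, rep_iso B (rep_sum A C).
Proof.
case=> i [p [im pm ip]].
have [C [c [cm cf cp ck]]] := rep_ker pm.
pose e v := 1%:M - p v *m i v.
have ep v : e v *m p v = 0.
  by rewrite mulmxBl mul1mx -mulmxA ip mulmx1 subrr.
pose q v := e v *m pinvmx (c v).
have qc v : q v *m c v = e v.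
  by have [y ye] := ck v _ _ (ep v); rewrite /q ye mulmxKpV ?submxMl.
have qm : rep_morph q.
  apply: (rep_morph_mono cm cf) => a; rewrite /comp_fam !qc /e.
  rewrite mulmxBl mulmxBr mulmx1 mul1mx; congr (_ - _).
  by rewrite mulmxA pm -!mulmxA im.
have iq v : i v *m q v = 0.
  apply: (row_free_cancel (cf v)).
  by rewrite -mulmxA qc mul0mx mulmxBr mulmx1 mulmxA ip mul1mx subrr.
have cq v : c v *m q v = 1%:M.
  apply: (row_free_cancel (cf v)).
  by rewrite -mulmxA qc mul1mx mulmxBr mulmx1 mulmxA cp mul0mx subr0.
exists C, (fun v => row_mx (p v) (q v)), (fun v => col_mx (i v) (c v)); split.
- by move=> a /=; rewrite mul_mx_row pm qm mul_row_block !mulmx0 addr0 add0r.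
- by move=> a /=; rewrite mul_block_col mul_col_mx im cm !mul0mx addr0 add0r.
- by move=> v; rewrite mul_row_col qc addrC subrK.
- by move=> v; rewrite mul_col_row ip iq cp cq -scalar_mx_block.
Qed.

(** Only the equality of dimensions is recorded, since summands of an
    indecomposable are always compared through their dimensions. *)
Lemma indecomposable_summand A B v : rep_indecomposable B -> rep_nonzero A ->
  summand A B -> rdim A v = rdim B v.
Proof.
move=> [_ Bi] An AB; have [C BC] := summand_complement AB.
rewrite (rep_iso_dim v BC) /=; suff -> : rdim C v = 0%N by rewrite addn0.
by apply/eqP; apply: contrapT => /negP Cv; apply: (Bi _ _ BC); split=> //; exists v.
Qed.

Lemma rep_iso_indecomposable A B : rep_iso A B -> rep_indecomposable A ->
  rep_indecomposable B.
Proof.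
move=> AB [[v vA] Ai]; split; first by exists v; rewrite -(rep_iso_dim v AB).
by move=> W1 W2 BW; apply: Ai; exact: rep_iso_trans AB BW.
Qed.

End Morphisms.

(** * Vanishing of Ext *)
Section Extensions.

Variables (n : nat) (k : fieldType) (Q : quiver n).
Local Notation rep := (representation k Q).
Local Notation fam A B := (forall v, 'M[k]_(rdim A v, rdim B v)).
Implicit Types A B C M N X Y : rep.

(** [dim_ext A B = 0] in terms of families of matrices. *)
Definition ext_vanishes A B : Prop :=
  forall z : (forall a : arrow Q, 'M[k]_(rdim A (src a), rdim B (tgt a))),
  exists h : fam A B,
    forall a, z a = rmap A a *m h (tgt a) - h (src a) *m rmap B a.

Lemma ext_vanishesP A B : ext_vanishes A B <-> dim_ext A B = 0%N.
Proof.
rewrite /dim_ext; split=> [v0|/eqP].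
  apply/eqP; rewrite subn_eq0; apply: dimvS; apply/subvP => z _.
  have [h hE] := v0 (cochain1_mx z); have [h' h'E] := cochain0_mxP h.
  apply/memv_imgP; exists h'; first exact: memvf.
  rewrite lfunE /=; apply: cochain1_mx_inj => a.
  by rewrite ext_diff_mx !h'E.
rewrite subn_eq0 => le z; have [z' z'E] := cochain1_mxP z.
have /eqP lf : limg (linfun (@ext_diff n k Q A B)) == fullv.
  by rewrite eqEdim subvf.
have /memv_imgP[h _ e] : z' \in limg (linfun (@ext_diff n k Q A B)).
  by rewrite lf memvf.
exists (cochain0_mx h) => a; rewrite -z'E e lfunE /=; exact: ext_diff_mx.
Qed.

(** [Ext^1] is an additive functor in both arguments. *)
Lemma ext_vanishes_summand A A' B B' :
  summand A A' -> summand B B' -> ext_vanishes A' B' -> ext_vanishes A B.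
Proof.
move=> [i [p [im pm ip]]] [i' [p' [im' pm' ip']]] e z.
have [h hE] := e (fun a => p (src a) *m z a *m i' (tgt a)).
exists (fun v => i v *m h v *m p' v) => a.
have := congr1 (fun x => i (src a) *m x *m p' (tgt a)) (hE a).
rewrite -!mulmxA ip' mulmx1 !mulmxA ip mul1mx mulmxBr mulmxBl => ->.
by rewrite !mulmxA -im -!mulmxA pm'.
Qed.

Lemma ext_vanishes_iso A A' B B' :
  rep_iso A A' -> rep_iso B B' -> ext_vanishes A B -> ext_vanishes A' B'.
Proof.
move=> /rep_iso_sym/rep_iso_summand s /rep_iso_sym/rep_iso_summand s'.
exact: ext_vanishes_summand.
Qed.

Lemma ext_vanishes_suml A1 A2 B :
  ext_vanishes A1 B -> ext_vanishes A2 B -> ext_vanishes (rep_sum A1 A2) B.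
Proof.
move=> e1 e2 z.
have [i1 [i2 [p1 [p2 [[im1 im2 pm1 pm2] [_ _ _ _ ip]]]]]] := rep_sum_biproduct A1 A2.
have [h1 h1E] := e1 (fun a => i1 (src a) *m z a).
have [h2 h2E] := e2 (fun a => i2 (src a) *m z a).
exists (fun v => p1 v *m h1 v + p2 v *m h2 v) => a.
rewrite mulmxDr mulmxDl !mulmxA pm1 pm2 opprD addrACA -!mulmxA -!mulmxBr.
by rewrite -h1E -h2E !mulmxA -mulmxDl ip mul1mx.
Qed.

Lemma ext_vanishes_sumr A B1 B2 :
  ext_vanishes A B1 -> ext_vanishes A B2 -> ext_vanishes A (rep_sum B1 B2).
Proof.
move=> e1 e2 z.
have [i1 [i2 [p1 [p2 [[im1 im2 pm1 pm2] [_ _ _ _ ip]]]]]] := rep_sum_biproduct B1 B2.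
have [h1 h1E] := e1 (fun a => z a *m p1 (tgt a)).
have [h2 h2E] := e2 (fun a => z a *m p2 (tgt a)).
exists (fun v => h1 v *m i1 v + h2 v *m i2 v) => a.
rewrite mulmxDr mulmxDl -!mulmxA -im1 -im2 !mulmxA opprD addrACA -!mulmxBl.
by rewrite -h1E -h2E -!mulmxA -mulmxDr ip mulmx1.
Qed.

(** Quivers are hereditary: [Ext^1] is right exact, so its vanishing passes
    to subrepresentations in the first argument. *)
Lemma ext_vanishes_mono A A' B (f : fam A A') :
  rep_morph f -> (forall v, row_free (f v)) ->
  ext_vanishes A' B -> ext_vanishes A B.
Proof.
move=> fm ff e z.
have [h hE] := e (fun a => pinvmx (f (src a)) *m z a).
exists (fun v => f v *m h v) => a.
have := congr1 (fun x => f (src a) *m x) (hE a).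
have -> : f (src a) *m (pinvmx (f (src a)) *m z a) = z a.
  by rewrite mulmxA mulmxVp // mul1mx.
by move=> ->; rewrite mulmxBr !mulmxA fm.
Qed.

(** If [pr : M -> I] has kernel [K] and [Ext^1(I, N)] vanishes, morphisms
    [K -> N] extend to [M]: the obstruction lies in [Ext^1(I, N)]. *)
Lemma rep_morph_extend M I K N (pr : fam M I) (s : fam I M) (kappa : fam K M)
    (f : fam K N) :
  rep_morph pr -> rep_morph kappa -> rep_morph f ->
  (forall v, s v *m pr v = 1%:M) -> (forall v, row_free (kappa v)) ->
  (forall v, kappa v *m pr v = 0) ->
  (forall v m (x : 'M[k]_(m, rdim M v)), x *m pr v = 0 ->
     exists y, x = y *m kappa v) ->
  ext_vanishes I N ->
  exists g : fam M N, rep_morph g /\ forall v, kappa v *m g v = f v.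
Proof.
move=> prm km fm sp kf kp kk e.
have [g0 kg0] : exists g0 : fam M N, forall v, kappa v *m g0 v = f v.
  by exists (fun v => pinvmx (kappa v) *m f v) => v; rewrite mulmxA mulmxVp // mul1mx.
pose c a := rmap M a *m g0 (tgt a) - g0 (src a) *m rmap N a.
have kc a : kappa (src a) *m c a = 0.
  rewrite mulmxBr; apply/eqP; rewrite subr_eq0; apply/eqP.
  by rewrite mulmxA -km -mulmxA kg0 fm mulmxA kg0.
have cE a : c a = pr (src a) *m (s (src a) *m c a).
  pose d := 1%:M - pr (src a) *m s (src a).
  have [|y yE] := kk _ _ d.
    by rewrite mulmxBl mul1mx -mulmxA sp mulmx1 subrr.
  have : d *m c a = 0 by rewrite yE -mulmxA kc mulmx0.
  by rewrite mulmxBl mul1mx => /eqP; rewrite subr_eq0 mulmxA => /eqP.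
have [h hE] := e (fun a => s (src a) *m c a).
exists (fun v => g0 v - pr v *m h v); split.
  move=> a; rewrite mulmxBr mulmxBl.
  have : rmap M a *m g0 (tgt a) - g0 (src a) *m rmap N a =
    rmap M a *m (pr (tgt a) *m h (tgt a)) - pr (src a) *m h (src a) *m rmap N a.
    by rewrite -/(c a) cE hE mulmxBr !mulmxA prm.
  move/eqP; rewrite subr_eq => /eqP ->.
  by rewrite addrC -addrA addKr addrC.
by move=> v; rewrite mulmxBr kg0 mulmxA kp mul0mx subr0.
Qed.

End Extensions.

(** * Ringel's lemma *)
Section Bricks.

Lemma nat_least (P : nat -> Prop) : (exists m, P m) ->
  exists m, P m /\ forall m', P m' -> (m <= m')%N.
Proof.
move=> exP; have exb : exists m, `[< P m >].
  by case: exP => m Pm; exists m; apply/asboolP.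
exists (ex_minn exb); case: ex_minnP => m /asboolP Pm mmin; split=> // m' Pm'.
exact/mmin/asboolP.
Qed.

Variables (n : nat) (k : closedFieldType) (Q : quiver n).
Local Notation rep := (representation k Q).
Local Notation fam A B := (forall v, 'M[k]_(rdim A v, rdim B v)).
Implicit Types A B C I K M N W X Y : rep.

Definition brick M : Prop :=
  forall f : fam M M, rep_morph f -> exists c, forall v, f v = c%:M.

Definition total_rank M N (f : fam M N) := (\sum_v \rank (f v))%N.

Lemma total_rank_gt0 M N (f : fam M N) v : f v <> 0 -> (0 < total_rank f)%N.
Proof.
move=> fv; rewrite lt0n sum_nat_eq0 negb_forall; apply/existsP; exists v => /=.
by rewrite mxrank_eq0; exact/eqP.
Qed.

Lemma total_rank_neq0 M N (f : fam M N) : (0 < total_rank f)%N ->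
  exists v, f v <> 0.
Proof.
rewrite lt0n sum_nat_eq0 negb_forall => /existsP[v /= fv]; exists v.
by apply/eqP; rewrite -mxrank_eq0.
Qed.

Lemma leq_sum_eq (I : finType) (F G : I -> nat) :
  (forall i, F i <= G i)%N -> (\sum_i G i <= \sum_i F i)%N ->
  forall i, F i = G i.
Proof.
move=> FG; have lif : (\sum_i F i <= \sum_i G i ?= iff [forall i, F i == G i])%N.
  by apply: leqif_sum => i _; split.
move=> GF i; have : (\sum_i F i == \sum_i G i)%N.
  by rewrite eqn_leq GF andbT; exact: leq_sum.
by rewrite lif => /forallP/(_ i)/eqP.
Qed.

(** Subtracting an eigenvalue makes a nonscalar endomorphism singular; this is
    where [k] is algebraically closed. *)
Lemma not_brick_endomorphism M : rep_nonzero M -> ~ brick M ->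
  exists f : fam M M,
    [/\ rep_morph f, (0 < total_rank f)%N & (total_rank f < total_dim M)%N].
Proof.
move=> [v0 Mv0] /existsNP[f /not_implyP[fm /forallNP fc]].
have [l fl] : exists l : k, root (char_poly (f v0)) l.
  by apply/closed_rootP; rewrite size_char_poly eqSS.
have {fc} [v fv] := (existsNP _).2 (fc l).
pose g v : 'M[k]_(rdim M v) := f v - l%:M.
have gv0 : (\rank (g v0) < rdim M v0)%N.
  rewrite ltn_neqAle rank_leq_row andbT.
  move: fl; rewrite -eigenvalue_root_char /eigenvalue /eigenspace.
  by rewrite kermx_eq0.
exists g; split.
- by move=> a; rewrite /g mulmxBr mulmxBl fm scalar_mxC.
- apply: (@total_rank_gt0 _ _ _ v) => gv; apply: fv.
  by apply/eqP; rewrite -subr_eq0 -/(g v) gv.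
- rewrite ltnNge; apply/negP => le.
  have := leq_sum_eq (fun v => rank_leq_row (g v)) le v0.
  by move=> e; rewrite e ltnn in gv0.
Qed.

Lemma row_free_dim_lt M K (kappa : fam K M) : (forall v, row_free (kappa v)) ->
  (exists v, ~~ row_full (kappa v)) -> (total_dim K < total_dim M)%N.
Proof.
move=> kf [v kv]; rewrite ltnNge; apply/negP => le.
have lK v' : (rdim K v' <= rdim M v')%N.
  by rewrite -(eqP (kf v')) rank_leq_col.
by move: kv; rewrite /row_full (eqP (kf v)) (leq_sum_eq lK le) eqxx.
Qed.

(** Let [f] be a nonzero endomorphism of [M] of least rank, with image [I] and
    kernel [K]. By Fitting, [f] squares to zero, so that [I] embeds in [K]. Let [N]
    be an indecomposable summand of [K] on which [I] has a nonzero projection,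
    which is injective since the rank of [f] is minimal. By induction [N] is a brick,
    hence rigid, so [Ext(I, N)] vanishes and the projection [K -> N] extends to
    [M]: the proper subrepresentation [N] is a summand of [M]. *)
Lemma indecomposable_brick :
  (forall N, rep_nonzero N -> brick N -> ext_vanishes N N) ->
  forall M, rep_indecomposable M -> brick M.
Proof.
move=> rig M; have [d] := ubnP (total_dim M); elim: d M => // d IH M; rewrite ltnS => Md Mi.
apply: contrapT => nb.
have [f1 [f1m f1gt f1lt]] := not_brick_endomorphism Mi.1 nb.
have [|r [[f [fm fr r0]] fmin]] := @nat_least (fun r =>
  exists f : fam M M, [/\ rep_morph f, total_rank f = r & (0 < r)%N]).
  by exists (total_rank f1), f1.
have {}fmin (g : fam M M) : rep_morph g -> (0 < total_rank g)%N -> (r <= total_rank g)%N.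
  by move=> gm g0; apply: fmin; exists g.
have [I [pr [iota [s [[prm im fE if_sp] dI]]]]] := rep_image fm.
have jf v := (if_sp v).1; have sp v := (if_sp v).2.
have dimI : total_dim I = r by rewrite -fr; apply: eq_bigr => v _; exact: dI.
have IM : (total_dim I < total_dim M)%N.
  by rewrite dimI; apply: leq_ltn_trans f1lt; exact: fmin.
have noI N : rep_nonzero N -> (total_dim N < total_dim M)%N -> ~ summand N M.
  move=> N0 NM sNM; move: NM; rewrite ltnNge => /negP; apply.
  by apply: leq_sum => v _; rewrite (indecomposable_summand v Mi N0 sNM).
(* Otherwise [f] restricts to an automorphism of [I], and [I] is a summand. *)
have ip0 v : iota v *m pr v = 0.
  apply: contrapT => nz; pose u v := iota v *m pr v.
  have um : @rep_morph _ _ _ I I u by exact: (rep_morph_comp im prm).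
  pose ff : fam M M := fun v => f v *m f v.
  have ffE w : ff w = pr w *m (u w *m iota w).
    by rewrite /ff !fE /u !mulmxA.
  have ff0 : (0 < total_rank ff)%N.
    apply: (@total_rank_gt0 _ _ _ v); rewrite ffE => e; apply: nz.
    have := congr1 (mulmx (s v)) e; rewrite mulmxA sp mul1mx mulmx0.
    by rewrite -(mul0mx _ (iota v)) => /(row_free_cancel (jf v)).
  have lt1 w : (\rank (u w) <= rdim I w)%N by exact: rank_leq_row.
  have lt2 : (\sum_w rdim I w <= \sum_w \rank (u w))%N.
    rewrite -/(total_dim I) dimI; apply: leq_trans (fmin ff _ ff0) _.
      exact: (rep_morph_comp fm fm).
    apply: leq_sum => w _; rewrite ffE; apply: leq_trans (mxrankM_maxr _ _) _.
    exact: mxrankM_maxl.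
  have uu w : u w \in unitmx.
    by rewrite -row_free_unit /row_free (leq_sum_eq lt1 lt2).
  have vm : @rep_morph _ _ _ I I (fun w => invmx (u w)).
    apply: (rep_morph_inverse um) => w; [exact: mulmxV|exact: mulVmx].
  apply: (noI I) => //; first by apply/rep_nonzeroP; rewrite dimI.
  exists iota, (comp_fam pr (fun w => invmx (u w))); split=> //.
    exact: (rep_morph_comp prm vm).
  by move=> w; rewrite /comp_fam mulmxA mulmxV.
have [K [kappa [km kf kp kk]]] := rep_ker prm.
have KM : (total_dim K < total_dim M)%N.
  have [|v fv] := @total_rank_neq0 _ _ f; first by rewrite fr.
  apply: (row_free_dim_lt kf); exists v; apply/negP => /row_fullP[b bk].
  by apply: fv; rewrite fE -[X in X *m _](mul1mx (pr v)) -bk -[X in X *m _]mulmxA kp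
      mulmx0 mul0mx.
pose iota' v : 'M[k]_(rdim I v, rdim K v) := iota v *m pinvmx (kappa v).
have i'E v : iota v = iota' v *m kappa v.
  by have [y yE] := kk v _ _ (ip0 v); rewrite mulmxKpV // yE submxMl.
have i'm : rep_morph iota'.
  by apply: (rep_morph_mono km kf) => a; rewrite /comp_fam -!i'E; exact: im.
have [|m [[N [i [p [[jm pm ip] Nm [v0 v0E]]]]] mmin]] := @nat_least (fun m =>
  exists (N : rep) (i : fam N K) (p : fam K N),
  [/\ [/\ rep_morph i, rep_morph p & forall v, i v *m p v = 1%:M],
      total_dim N = m & exists v, iota' v *m p v <> 0]).
  exists (total_dim K), K, (fun v => 1%:M), (fun v => 1%:M); split=> //.
    by split; [exact: rep_morph_id|exact: rep_morph_id|move=> v; rewrite mulmx1].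
  have [|v fv] := @total_rank_neq0 _ _ f; first by rewrite fr.
  by exists v; rewrite mulmx1 => e; apply: fv; rewrite fE i'E e mul0mx mulmx0.
(* [N] has minimal dimension among the summands of [K] on which the projection
   of [I] is nonzero; this makes it indecomposable. *)
have small W (j : fam W N) (q : fam N W) v : rep_morph j -> rep_morph q ->
    (forall v, j v *m q v = 1%:M) -> (total_dim W < total_dim N)%N ->
    iota' v *m p v *m q v = 0.
  move=> jm' qm jq WN; apply: contrapT => nz.
  move: WN; rewrite ltnNge => /negP; apply; rewrite Nm; apply: mmin.
  exists W, (comp_fam j i), (comp_fam p q); split=> //.
    split; [exact: rep_morph_comp|exact: rep_morph_comp|].
    by move=> w; rewrite /comp_fam mulmxA -(mulmxA (j w)) ip mulmx1.
  by exists v; rewrite /comp_fam mulmxA.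
have Nn : rep_nonzero N.
  exists v0; apply/eqP => N0; apply: v0E; apply/eqP; rewrite -mxrank_eq0 -leqn0.
  by rewrite -[X in (_ <= X)%N]N0 rank_leq_col.
have Ni : rep_indecomposable N.
  split=> // W1 W2 NW [/rep_nonzeroP W1n /rep_nonzeroP W2n].
  have dN : total_dim N = (total_dim W1 + total_dim W2)%N.
    rewrite /total_dim -big_split; apply: eq_bigr => v _; exact: rep_iso_dim NW.
  case: NW => g [h [gm hm gh hg]].
  have [i1 [i2 [p1 [p2 [[im1 im2 pm1 pm2] [ip1 ip2 _ _ e]]]]]] := rep_sum_biproduct W1 W2.
  have z1 : iota' v0 *m p v0 *m (g v0 *m p1 v0) = 0.
    apply: (small W1 (comp_fam i1 h) (comp_fam g p1)); try exact: rep_morph_comp.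
      by move=> w; rewrite /comp_fam mulmxA -(mulmxA (i1 w)) hg mulmx1.
    by rewrite dN -addn1 leq_add2l.
  have z2 : iota' v0 *m p v0 *m (g v0 *m p2 v0) = 0.
    apply: (small W2 (comp_fam i2 h) (comp_fam g p2)); try exact: rep_morph_comp.
      by move=> w; rewrite /comp_fam mulmxA -(mulmxA (i2 w)) hg mulmx1.
    by rewrite dN -[X in (X < _)%N]add0n ltn_add2r.
  apply: v0E; move: (iota' v0 *m p v0) z1 z2 => x; rewrite !mulmxA => z1 z2.
  have xg : x *m g v0 = 0.
    by rewrite -[LHS]mulmx1 -e mulmxDr !mulmxA z1 z2 !mul0mx addr0.
  by rewrite -[x]mulmx1 -gh mulmxA xg mul0mx.
have NK : (total_dim N <= total_dim K)%N.
  by apply: leq_sum => v _; apply: summand_dim; exists i, p.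
have Nd : (total_dim N < d)%N.
  by apply: leq_ltn_trans NK _; apply: leq_trans KM Md.
have Nr := rig N Nn (IH N Nd Ni).
pose al := comp_fam iota' p.
have alm : rep_morph al by exact: rep_morph_comp.
(* [M -> I -> N -> K -> M] is a nonzero endomorphism, of rank at most [dim I]. *)
have alf v : row_free (al v).
  pose be := comp_fam (comp_fam pr al) (comp_fam i kappa).
  have bem : rep_morph be by apply: rep_morph_comp; exact: rep_morph_comp.
  have be0 : (0 < total_rank be)%N.
    apply: (@total_rank_gt0 _ _ _ v0) => e; apply: v0E.
    have := congr1 (mulmx (s v0)) e.
    rewrite /be /comp_fam -/(al v0) !mulmxA sp mul1mx mulmx0.
    rewrite -(mul0mx _ (kappa v0)) => /(row_free_cancel (kf v0)).
    move=> /(congr1 (mulmx^~ (p v0))).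
    by rewrite mul0mx -!mulmxA ip mulmx1.
  have lt1 w : (\rank (al w) <= rdim I w)%N by exact: rank_leq_row.
  have lt2 : (\sum_w rdim I w <= \sum_w \rank (al w))%N.
    rewrite -/(total_dim I) dimI; apply: leq_trans (fmin be bem be0) _.
    apply: leq_sum => w _; apply: leq_trans (mxrankM_maxl _ _) _.
    exact: mxrankM_maxr.
  by rewrite /row_free (leq_sum_eq lt1 lt2).
have IN := ext_vanishes_mono alm alf Nr.
have [g [gm kg]] := rep_morph_extend prm km pm sp kf kp kk IN.
apply: (noI N) => //; first exact: leq_ltn_trans NK KM.
exists (comp_fam i kappa), g; split=> //; first exact: rep_morph_comp.
by move=> v; rewrite /comp_fam -mulmxA kg.
Qed.

End Bricks.

(** * Linear maps with coefficients in a ring of parameters *)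
Section Packing.

Variables (T : finType) (r c : T -> nat).

(** Families of matrices are turned into row vectors, so that the differential
    whose cokernel is [Ext] becomes a matrix with polynomial entries, to which
    determinants apply. *)
Definition pack (S : Type) (g : forall t, 'M[S]_(r t, c t)) :
    'rV[S]_#|{: {t : T & 'I_(r t) * 'I_(c t)}%type}| :=
  \row_i let e := enum_val i in g (tag e) (tagged e).1 (tagged e).2.

Definition unpack (S : Type) (h : 'rV[S]_#|{: {t : T & 'I_(r t) * 'I_(c t)}%type}|) t :
    'M[S]_(r t, c t) :=
  \matrix_(i, j) h 0 (enum_rank (Tagged (fun t => 'I_(r t) * 'I_(c t))%type (i, j))).

Lemma packK (S : Type) (g : forall t, 'M[S]_(r t, c t)) t : unpack (pack g) t = g t.
Proof. by apply/matrixP => i j; rewrite !mxE enum_rankK. Qed.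

Lemma unpackK (S : Type) (h : 'rV[S]_#|{: {t : T & 'I_(r t) * 'I_(c t)}%type}|) :
  pack (unpack h) = h.
Proof.
apply/rowP => i; rewrite mxE /= mxE -[in RHS](enum_valK i).
by case: (enum_val i) => t [].
Qed.

Lemma eq_pack (S : Type) (g g' : forall t, 'M[S]_(r t, c t)) :
  (forall t, g t = g' t) -> pack g = pack g'.
Proof. by move=> e; apply/rowP => i; rewrite !mxE /= e. Qed.

Lemma map_unpack (S S' : Type) (f : S -> S') h t :
  unpack (map_mx f h) t = map_mx f (unpack h t).
Proof. by apply/matrixP => i j; rewrite !mxE. Qed.

Lemma map_pack (S S' : Type) (f : S -> S') (g : forall t, 'M[S]_(r t, c t)) :
  map_mx f (pack g) = pack (fun t => map_mx f (g t)).
Proof. by apply/rowP => i; rewrite !mxE /= !mxE. Qed.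

End Packing.

Section Differential.

Variables (n : nat) (Q : quiver n) (alpha beta : 'I_n -> nat).
Local Notation arrows S d := (forall a : arrow Q, 'M[S]_(d (src a), d (tgt a))).

Definition diff_row (S : comNzRingType) (X : arrows S alpha) (Y : arrows S beta) h :=
  pack (fun a => X a *m @unpack _ alpha beta S h (tgt a)
                 - @unpack _ alpha beta S h (src a) *m Y a).

Fact diff_row_linear (S : comNzRingType) (X : arrows S alpha) (Y : arrows S beta) :
  linear (diff_row X Y).
Proof.
move=> e g h.
have cl v : unpack (e *: g + h) v = e *: unpack g v + unpack h v.
  by apply/matrixP => i j; rewrite !mxE.
apply/rowP => j; rewrite !mxE; move: (enum_val j) => [a [p q]] /=.
rewrite !cl mulmxDr mulmxDl -scalemxAr -scalemxAl !mxE; ring.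
Qed.

HB.instance Definition _ (S : comNzRingType) (X : arrows S alpha) (Y : arrows S beta) :=
  GRing.isLinear.Build S _ _ *:%R (diff_row X Y) (diff_row_linear X Y).

Definition diffmx (S : comNzRingType) (X : arrows S alpha) (Y : arrows S beta) :=
  lin1_mx (diff_row X Y).

Lemma mul_diffmx (S : comNzRingType) (X : arrows S alpha) (Y : arrows S beta) h :
  h *m diffmx X Y = diff_row X Y h.
Proof. exact: mul_rV_lin1. Qed.

(** The kernel of the differential is the space of morphisms. *)
Lemma mul_diffmx_eq0 (S : comNzRingType) (X : arrows S alpha) (Y : arrows S beta) h :
  h *m diffmx X Y = 0 <->
  forall a, X a *m unpack h (tgt a) = unpack h (src a) *m Y a.
Proof.
rewrite mul_diffmx; split=> [e a|e]; last first.
  by apply/rowP => i; rewrite [LHS]mxE /= e subrr !mxE.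
apply/eqP; rewrite -subr_eq0; apply/eqP.
rewrite -(packK (fun a => X a *m unpack h (tgt a) - unpack h (src a) *m Y a) a).
rewrite -/(diff_row X Y h) e; by apply/matrixP => i j; rewrite !mxE.
Qed.

Lemma map_diffmx (S S' : comNzRingType) (f : {rmorphism S -> S'})
    (X : arrows S alpha) (Y : arrows S beta) :
  map_mx f (diffmx X Y) =
  diffmx (fun a => map_mx f (X a)) (fun a => map_mx f (Y a)).
Proof.
apply/row_matrixP => i; rewrite -map_row !rowE !mul_diffmx /diff_row map_pack.
by apply: eq_pack => a; rewrite map_mxB !map_mxM -!map_unpack map_delta_mx.
Qed.

Variable k : fieldType.

Lemma ext_vanishes_row_full (x : arrows k alpha) (y : arrows k beta) :
  ext_vanishes (Rep x) (Rep y) <-> row_full (diffmx x y).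
Proof.
split=> [e|/row_fullP[b bE] z].
  rewrite -sub1mx; apply/row_subP => i; rewrite rowE mulmx1.
  have [h hE] := e (unpack (delta_mx 0 i)).
  apply/submxP; exists (pack h); rewrite mul_diffmx -[LHS]unpackK; apply: eq_pack => a.
  by rewrite hE !packK.
exists (unpack (pack z *m b)) => a; rewrite -(packK z a).
by rewrite -[in LHS](mulmx1 (pack z)) -bE mulmxA mul_diffmx packK.
Qed.

End Differential.

(** * Deformations of rigid representations *)
Section Deformations.

Variables (k : fieldType) (S : comNzRingType) (c : {rmorphism k -> S}).

(** The ring [S] of parameters contains the constants [k] through [c]; its points
    are the retractions of [c]. *)
Definition specialization (ev : {rmorphism S -> k}) := cancel c ev.

Lemma map_specialization (ev : {rmorphism S -> k}) m1 m2 (x : 'M[k]_(m1, m2)) :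
  specialization ev -> map_mx ev (map_mx c x) = x.
Proof. by move=> evK; apply/matrixP => i j; rewrite !mxE evK. Qed.

(** If [A] is surjective at the point [ev], with right inverse [B] (row vectors
    act on the left), a kernel vector at [ev] extends to a kernel vector over the whole
    parameter space, by Cramer's rule for [D = B A]: take
    [det D x0 - x0 A adj(D) B]. *)
Lemma lift_kernel (ev : {rmorphism S -> k}) (p q : nat) (A : 'M[S]_(p, q))
    (B : 'M[k]_(q, p)) (x0 : 'rV[k]_p) :
  specialization ev -> B *m map_mx ev A = 1%:M -> x0 *m map_mx ev A = 0 ->
  exists x : 'rV[S]_p, x *m A = 0 /\ map_mx ev x = x0.
Proof.
move=> evK BA xA; pose D := map_mx c B *m A.
have D1 : map_mx ev D = 1%:M by rewrite map_mxM map_specialization.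
exists (\det D *: map_mx c x0 - map_mx c x0 *m A *m \adj D *m map_mx c B); split.
  rewrite mulmxBl -scalemxAl -[X in _ - X]mulmxA -/D -[X in _ - X]mulmxA mul_adj_mx.
  by rewrite mul_mx_scalar subrr.
rewrite map_mxB map_mxZ -det_map_mx D1 det1 scale1r !map_mxM !map_specialization //.
by rewrite xA !mul0mx subr0.
Qed.

Variables (n : nat) (Q : quiver n).
Local Notation arrows R d := (forall a : arrow Q, 'M[R]_(d (src a), d (tgt a))).
Local Notation specialize ev X := (fun a => map_mx (ev : {rmorphism S -> k}) (X a)).

(** [F] is the determinant of the composite of the differential with a right
    inverse at [ev0]. *)
Lemma ext_vanishes_open (alpha beta : 'I_n -> nat) (X : arrows S alpha)
    (Y : arrows S beta) (ev0 : {rmorphism S -> k}) :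
  specialization ev0 ->
  ext_vanishes (Rep (specialize ev0 X)) (Rep (specialize ev0 Y)) ->
  exists F : S, ev0 F = 1 /\
    forall ev, specialization ev -> ev F != 0 ->
      ext_vanishes (Rep (specialize ev X)) (Rep (specialize ev Y)).
Proof.
move=> ev0K /ext_vanishes_row_full/row_fullP[b]; rewrite -map_diffmx => bE.
exists (\det (map_mx c b *m diffmx X Y)); split.
  by rewrite -det_map_mx map_mxM map_specialization // bE det1.
move=> ev evK; rewrite -det_map_mx map_mxM map_specialization // map_diffmx => d0.
apply/ext_vanishes_row_full; rewrite -sub1mx.
apply: submx_trans (submxMl b _); rewrite sub1mx row_full_unit unitmxE.
by rewrite unitfE.
Qed.

(** The identity is a kernel vector of the differential of the pair
    [(M, X)] at [X = M], where it is surjective because [M] is rigid. Its extension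
    over the parameter space is a family of morphisms [M -> X], and
    [F] is the product of their determinants. *)
Lemma rigid_iso_open (alpha : 'I_n -> nat) (X : arrows S alpha)
    (ev0 : {rmorphism S -> k}) :
  specialization ev0 ->
  ext_vanishes (Rep (specialize ev0 X)) (Rep (specialize ev0 X)) ->
  exists F : S, ev0 F = 1 /\
    forall ev, specialization ev -> ev F != 0 ->
      rep_iso (Rep (specialize ev0 X)) (Rep (specialize ev X)).
Proof.
move=> ev0K /ext_vanishes_row_full/row_fullP[b bE].
pose m := specialize ev0 X.
pose A := diffmx (fun a => map_mx c (m a)) X.
have A0 : map_mx ev0 A = diffmx m m.
  rewrite map_diffmx; congr diffmx; apply/functional_extensionality_dep => a.
  by rewrite map_specialization.
have [||x [xA xE]] := @lift_kernel ev0 _ _ A b (pack (fun v => 1%:M)) ev0K.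
- by rewrite A0.
- by rewrite A0; apply/mul_diffmx_eq0 => a; rewrite !packK mulmx1 mul1mx.
exists (\prod_v \det (unpack x v)); split.
  rewrite rmorph_prod big1 // => v _.
  by rewrite -det_map_mx -map_unpack xE packK det1.
move=> ev evK; rewrite rmorph_prod => /prodf_neq0 F0.
pose g v := map_mx ev (unpack x v).
have gu v : g v \in unitmx by rewrite unitmxE unitfE det_map_mx F0.
have gm : @rep_morph n k Q (Rep m) (Rep (specialize ev X)) g.
  move=> a /=; move/mul_diffmx_eq0: xA => /(_ a)/(congr1 (map_mx ev)).
  by rewrite !map_mxM map_specialization.
exists g, (fun v => invmx (g v)); split=> //.
- by apply: (rep_morph_inverse gm) => v; [exact: mulmxV|exact: mulVmx].
- by move=> v; exact: mulmxV.
- by move=> v; exact: mulVmx.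
Qed.

End Deformations.

(** * Deformations along lines *)
Section Lines.

Variables (k : closedFieldType) (n : nat) (Q : quiver n).
Local Notation rep := (representation k Q).
Local Notation fam A B := (forall v, 'M[k]_(rdim A v, rdim B v)).
Local Notation arrows R d := (forall a : arrow Q, 'M[R]_(d (src a), d (tgt a))).
Implicit Types A B M N : rep.
Local Notation ev s := (map_mx (horner_eval (s : k))).

Lemma specialization_horner (s : k) :
  specialization (polyC : {rmorphism k -> {poly k}}) (horner_eval s).
Proof. by move=> x; rewrite /= /horner_eval hornerC. Qed.

Lemma poly_nonroot (p : {poly k}) : p != 0 -> exists s, p.[s] != 0.
Proof. by move=> /closed_nonrootP[s ps]; exists s. Qed.

(** The line through [x] and [y], as a representation over [k[s]]. *)
Definition pencil d (x y : arrows k d) : arrows {poly k} d :=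
  fun a => map_mx polyC (x a) + 'X *: map_mx polyC (y a - x a).

Lemma pencil_eval d (x y : arrows k d) s a :
  ev s (pencil x y a) = x a + s *: (y a - x a).
Proof. by apply/matrixP => i j; rewrite !mxE /horner_eval !hornerE. Qed.

Lemma pencil0 d (x y : arrows k d) : (fun a => ev 0 (pencil x y a)) = x.
Proof. by apply/functional_extensionality_dep => a; rewrite pencil_eval scale0r addr0. Qed.

Lemma pencil1 d (x y : arrows k d) : (fun a => ev 1 (pencil x y a)) = y.
Proof. by apply/functional_extensionality_dep => a; rewrite pencil_eval scale1r addrC
    subrK. Qed.

(** Representations with pointwise equal dimensions live on the same affine
    space of matrices. *)
Lemma rep_cast (d : 'I_n -> nat) (M : rep) : (forall v, rdim M v = d v) ->
  exists x : arrows k d, M = Rep x.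
Proof.
case: M => r x /= rd; have {}rd : r = d by apply/funext.
by case: d / rd; exists x.
Qed.

(** Along the pencil through two rigid representations, the generic member is
    isomorphic to both. *)
Lemma rigid_iso M N : (forall v, rdim M v = rdim N v) ->
  ext_vanishes M M -> ext_vanishes N N -> rep_iso M N.
Proof.
move=> dE; have [x ->] := rep_cast dE; case: N x {dE} => d y /= x xr yr.
have [|F [F1 FE]] := rigid_iso_open (X := pencil x y) (specialization_horner 0).
  by rewrite pencil0.
have [|G [G1 GE]] := rigid_iso_open (X := pencil x y) (specialization_horner 1).
  by rewrite pencil1.
have [|s] := @poly_nonroot (F * G).
  rewrite mulf_neq0 //; apply/eqP => e; [move: F1|move: G1]; rewrite e rmorph0 => /eqP;
    by rewrite eq_sym oner_eq0.
rewrite hornerM mulf_eq0 negb_or => /andP[Fs Gs].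
have := FE _ (specialization_horner s) Fs; rewrite pencil0 => xs.
have := GE _ (specialization_horner s) Gs; rewrite pencil1 => ys.
exact: rep_iso_trans xs (rep_iso_sym ys).
Qed.

(** Rigid representations realize the minimum of [dim Ext]: deform [M] to [A] and
    [N] to [B] simultaneously. *)
Lemma rigid_ext_vanishes M N A B :
  (forall v, rdim A v = rdim M v) -> (forall v, rdim B v = rdim N v) ->
  ext_vanishes M M -> ext_vanishes N N -> ext_vanishes A B -> ext_vanishes M N.
Proof.
move=> dA dB; have [a ->] := rep_cast dA; have [b ->] := rep_cast dB.
case: M a {dA} => d x /= a; case: N b {dB} => e y /= b xr yr ab.
have [|F [F1 FE]] := rigid_iso_open (X := pencil x a) (specialization_horner 0).
  by rewrite pencil0.
have [|G [G1 GE]] := rigid_iso_open (X := pencil y b) (specialization_horner 0).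
  by rewrite pencil0.
have [|H [H1 HE]] := ext_vanishes_open (X := pencil x a) (Y := pencil y b)
  (specialization_horner 1); first by rewrite !pencil1.
have [|s] := @poly_nonroot (F * G * H).
  rewrite !mulf_neq0 //; apply/eqP => z; [move: F1|move: G1|move: H1];
    by rewrite z rmorph0 => /eqP; rewrite eq_sym oner_eq0.
rewrite !hornerM !mulf_eq0 !negb_or => /andP[/andP[Fs Gs] Hs].
have := FE _ (specialization_horner s) Fs; rewrite pencil0 => xs.
have := GE _ (specialization_horner s) Gs; rewrite pencil0 => ys.
apply: ext_vanishes_iso (rep_iso_sym xs) (rep_iso_sym ys) _.
exact: HE (specialization_horner s) Hs.
Qed.

(** Kernel vectors extend along a line as soon as the rank does not go up: a minor
    of maximal size at 0 reduces this to [lift_kernel], and as the rank stays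
    bounded the remaining equations follow from those of the minor wherever it is
    nonzero, hence identically. *)
Lemma lift_kernel_rank (p q : nat) (A : 'M[{poly k}]_(p, q)) (x0 : 'rV[k]_p) :
  (forall s, \rank (ev s A) <= \rank (ev 0 A))%N -> x0 *m ev 0 A = 0 ->
  exists x : 'rV[{poly k}]_p, x *m A = 0 /\ ev 0 x = x0.
Proof.
move=> rk x0A; pose r := \rank (ev 0 A).
have [L LE] : exists L : 'M[k]_(r, p), L *m col_base (ev 0 A) = 1%:M.
  by apply/row_fullP; exact: col_base_full.
have [R RE] : exists R : 'M[k]_(q, r), row_base (ev 0 A) *m R = 1%:M.
  by apply/row_freeP; exact: row_base_free.
pose A' := A *m map_mx polyC R.
have A's s : ev s A' = ev s A *m R.
  by rewrite map_mxM (map_specialization _ (specialization_horner s)).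
clearbody A'; have LA : L *m ev 0 A' = 1%:M.
  by rewrite A's -[X in L *m (X *m R)]mulmx_base -[_ *m _ *m R]mulmxA RE mulmx1 LE.
have [|x [xA xE]] := lift_kernel (specialization_horner 0) LA (x0 := x0).
  by rewrite A's mulmxA x0A mul0mx.
exists x; split=> //; pose D := \det (map_mx polyC L *m A').
have D0 : D != 0.
  apply/eqP => D0; have /eqP := det1 k r; rewrite -LA.
  have -> : L *m ev 0 A' = ev 0 (map_mx polyC L *m A').
    by rewrite map_mxM (map_specialization _ (specialization_horner 0)).
  by rewrite det_map_mx -/D D0 rmorph0 eq_sym oner_eq0.
have key s : D.[s] != 0 -> ev s (x *m A) = 0.
  move=> Ds; set As := ev s A.
  have LAR : L *m As *m R \in unitmx.
    have : \det (ev s (map_mx polyC L *m A')) != 0 by rewrite det_map_mx.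
    rewrite unitmxE unitfE map_mxM.
    by rewrite (map_specialization _ (specialization_horner s)) A's mulmxA.
  have sub : (As <= L *m As)%MS.
    have /mxrank_leqif_sup lif := submxMl L As.
    rewrite -lif eqn_leq (mxrankS (submxMl _ _)) /=.
    apply: leq_trans (rk s) _; rewrite -/r.
    by have := mxrankM_maxl (L *m As) R; rewrite (mxrank_unit LAR).
  have /submxP[y yE] : (ev s x *m As <= L *m As)%MS.
    exact: submx_trans (submxMl _ _) sub.
  have : ev s x *m As *m R = 0.
    by rewrite -mulmxA -A's -map_mxM xA map_mx0.
  rewrite yE -mulmxA => /(congr1 (mulmx^~ (invmx (L *m As *m R)))).
  by rewrite mul0mx mulmxK // map_mxM -/As yE => ->; rewrite mul0mx.
apply/matrixP => i j; rewrite [RHS]mxE.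
have : D * (x *m A) i j = 0.
  apply/eqP; apply/closed_nonrootP => -[s]; rewrite /root hornerM.
  have [->|Ds] := eqVneq D.[s] 0; first by rewrite mul0r eqxx.
  have /matrixP/(_ i j) := key s Ds; rewrite mxE [RHS]mxE /horner_eval => ->.
  by rewrite mulr0 eqxx.
by move/eqP; rewrite mulf_eq0 (negPf D0) => /eqP.
Qed.

Lemma deriv0_mulmx p q r (A : 'M[{poly k}]_(p, q)) (B : 'M[{poly k}]_(q, r)) :
  map_mx (fun f => f^`().[0]) (A *m B) =
  map_mx (fun f => f^`().[0]) A *m ev 0 B + ev 0 A *m map_mx (fun f => f^`().[0]) B.
Proof.
apply/matrixP => i j; rewrite !mxE raddf_sum /= horner_sum -big_split.
by apply: eq_bigr => l _; rewrite !mxE derivM hornerD !hornerM.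
Qed.

(** Where [dim Hom(M, M)] is minimal, endomorphisms extend along every
    deformation of [M]; to first order, [End(M)] acts centrally on
    [Ext^1(M, M)], and the projections of a decomposition kill the extensions
    between distinct summands. *)
Lemma hom_minimal_ext (d : 'I_n -> nat) (m : arrows k d) (A B : rep) :
  (forall m' : arrows k d, \rank (diffmx m' m') <= \rank (diffmx m m))%N ->
  rep_iso (Rep m) (rep_sum A B) -> ext_vanishes A B.
Proof.
move=> mmax [g [h [gm hm gh hg]]] z.
have [jA [jB [qA [qB [[jAm jBm qAm qBm] [jqA jqB jAqB jBqA _]]]]]] :=
  rep_sum_biproduct A B.
pose iA := comp_fam jA h; pose iB := comp_fam jB h.
pose pA := comp_fam g qA; pose pB := comp_fam g qB.
have iAm : rep_morph iA by exact: rep_morph_comp.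
have iBm : rep_morph iB by exact: rep_morph_comp.
have pAm : rep_morph pA by exact: rep_morph_comp.
have pBm : rep_morph pB by exact: rep_morph_comp.
have iApA v : iA v *m pA v = 1%:M.
  by rewrite /iA /pA /comp_fam mulmxA -(mulmxA (jA v)) hg mulmx1.
have iBpB v : iB v *m pB v = 1%:M.
  by rewrite /iB /pB /comp_fam mulmxA -(mulmxA (jB v)) hg mulmx1.
have iApB v : iA v *m pB v = 0.
  by rewrite /iA /pB /comp_fam mulmxA -(mulmxA (jA v)) hg mulmx1.
clearbody iA iB pA pB.
pose Z a : 'M[k]_(d (src a), d (tgt a)) := pA (src a) *m z a *m iB (tgt a).
pose X : arrows {poly k} d := fun a => map_mx polyC (m a) + 'X *: map_mx polyC (Z a).
have Xs s a : ev s (X a) = m a + s *: Z a.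
  by apply/matrixP => i j; rewrite !mxE /horner_eval !hornerE.
have X0 : (fun a => ev 0 (X a)) = m.
  by apply/functional_extensionality_dep => a; rewrite Xs scale0r addr0.
have X' a : map_mx (fun f => f^`().[0]) (X a) = Z a.
  rewrite /X; move: (Z a) => Za; apply/matrixP => i j.
  rewrite !mxE derivD derivM !derivC derivX.
  by rewrite mulr0 addr0 mul1r add0r hornerC.
pose e v : 'M[k]_(d v) := pB v *m iB v.
have em a : m a *m e (tgt a) = e (src a) *m m a.
  exact: (@rep_morph_comp _ _ _ (Rep m) B (Rep m) pB iB pBm iBm a).
have [||x [/mul_diffmx_eq0 xX xE]] := @lift_kernel_rank _ _ (diffmx X X) (pack e).
- by move=> s; rewrite !map_diffmx X0; exact: mmax.
- by rewrite map_diffmx X0; apply/mul_diffmx_eq0 => a; rewrite !packK.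
pose E v := unpack x v.
have E0 v : ev 0 (E v) = e v by rewrite -map_unpack xE packK.
pose E' v := map_mx (fun f => f^`().[0]) (E v).
have first_order a : Z a *m e (tgt a) + m a *m E' (tgt a) =
                     E' (src a) *m m a + e (src a) *m Z a.
  have := congr1 (map_mx (fun f => f^`().[0])) (xX a).
  by rewrite !deriv0_mulmx X' !E0 Xs scale0r addr0.
exists (fun v => - (iA v *m E' v *m pB v)) => a.
have := congr1 (fun y => iA (src a) *m y *m pB (tgt a)) (first_order a).
rewrite !mulmxDr !mulmxDl.
have -> : iA (src a) *m (Z a *m e (tgt a)) *m pB (tgt a) = z a.
  by rewrite /Z /e !mulmxA iApA mul1mx -!mulmxA iBpB mulmx1 iBpB mulmx1.
have -> : iA (src a) *m (e (src a) *m Z a) *m pB (tgt a) = 0.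
  by rewrite /e !mulmxA iApB !mul0mx.
have -> : iA (src a) *m (m a *m E' (tgt a)) *m pB (tgt a) =
          rmap A a *m (iA (tgt a) *m E' (tgt a) *m pB (tgt a)).
  by rewrite !mulmxA iAm.
have -> : iA (src a) *m (E' (src a) *m m a) *m pB (tgt a) =
          iA (src a) *m E' (src a) *m pB (src a) *m rmap B a.
  by rewrite -!mulmxA -pBm.
rewrite addr0 mulmxN mulNmx opprK => /eqP; rewrite -subr_eq0 => /eqP zE.
by apply/eqP; rewrite -subr_eq0 opprD opprK addrA zE.
Qed.

End Lines.

(** * The Tits form and rigid representations *)
Section TitsForm.

Variables (n : nat) (Q : quiver n).

Definition tits_form (x : 'I_n -> int) : int :=
  \sum_v x v ^+ 2 - \sum_(a : arrow Q) x (src a) * x (tgt a).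

Definition tits_positive : Prop :=
  forall x : 'I_n -> int, (exists v, x v != 0) -> 0 < tits_form x.

Hypothesis pos : tits_positive.

Lemma card_entries (T : finType) (r c : T -> nat) :
  #|{: {t : T & 'I_(r t) * 'I_(c t)}%type}| = (\sum_t r t * c t)%N.
Proof.
rewrite card_tagged sumnE big_map big_enum /=; apply: eq_bigr => t _.
by rewrite card_prod !card_ord.
Qed.

Variable k : closedFieldType.
Local Notation rep := (representation k Q).
Local Notation arrows R d := (forall a : arrow Q, 'M[R]_(d (src a), d (tgt a))).
Implicit Types A B C M N W : rep.

(** The Euler characteristic of the complex computing [Hom] and [Ext]. *)
Lemma tits_form_card (d : 'I_n -> nat) : tits_form (fun v => (d v)%:Z) =
  #|{: {v : 'I_n & 'I_(d v) * 'I_(d v)}%type}|%:Z -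
  #|{: {a : arrow Q & 'I_(d (src a)) * 'I_(d (tgt a))}%type}|%:Z.
Proof.
rewrite /tits_form !card_entries !(big_morph Posz PoszD (erefl _)).
congr (_ - _); apply: eq_bigr => v _; by rewrite ?expr2 PoszM.
Qed.

(** [dim Hom(M, M) <= 1]. *)
Lemma brick_kernel (d : 'I_n -> nat) (m : arrows k d) : brick (Rep m) ->
  (\rank (kermx (diffmx m m)) <= 1)%N.
Proof.
move=> Mb; have sub : (kermx (diffmx m m) <= pack (fun v => 1%:M : 'M[k]_(d v)))%MS.
  apply/row_subP => i.
  have /mul_diffmx_eq0 e : row i (kermx (diffmx m m)) *m diffmx m m = 0.
    by rewrite -row_mul mulmx_ker row0.
  have [|l lE] := Mb (unpack (row i (kermx (diffmx m m)))) => //.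
  apply/sub_rVP; exists l; rewrite -[LHS]unpackK.
  apply/rowP => j; rewrite !mxE /= lE.
  by rewrite !mxE /= mulr_natr.
by apply: leq_trans (mxrankS sub) _; exact: rank_leq_row.
Qed.

(** [q(dim M) = dim Hom(M, M) - dim Ext(M, M)], which is [1 - dim Ext(M, M)] when
    [M] is a brick. *)
Lemma brick_tits_le1 M : brick M ->
  tits_form (fun v => (rdim M v)%:Z) <= 1.
Proof.
case: M => d m /brick_kernel; rewrite mxrank_ker.
have := rank_leq_col (diffmx m m); move: (\rank _) => r.
by rewrite /= tits_form_card; move: r #|_| #|_| => r a b; lia.
Qed.

(** [dim Ext(M, M) = 1 - q(dim M)], and [q(dim M)] is positive. *)
Lemma brick_rigid M : rep_nonzero M -> brick M -> ext_vanishes M M.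
Proof.
case: M => d m [v0 dv0] Mb; apply/ext_vanishes_row_full.
rewrite /row_full eqn_leq rank_leq_col /=.
have := pos (x := fun v => (d v)%:Z) (ex_intro _ v0 dv0).
have := brick_kernel Mb; rewrite mxrank_ker; move: (\rank _) => r.
by rewrite tits_form_card; move: r #|_| #|_| => r a b; lia.
Qed.

Lemma indecomposable_rigid M : rep_indecomposable M -> ext_vanishes M M.
Proof.
move=> Mi; apply: brick_rigid; first exact: Mi.1.
exact: (indecomposable_brick brick_rigid).
Qed.

Lemma rep_sumC A B : rep_iso (rep_sum A B) (rep_sum B A).
Proof.
exists (fun v => block_mx 0 1%:M 1%:M 0), (fun v => block_mx 0 1%:M 1%:M 0); split.
- by move=> a /=; rewrite !mulmx_block !(mulmx0, mul0mx, mulmx1, mul1mx, addr0, add0r).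
- by move=> a /=; rewrite !mulmx_block !(mulmx0, mul0mx, mulmx1, mul1mx, addr0, add0r).
- by move=> v; rewrite !mulmx_block !(mulmx0, mul0mx, mulmx1, mul1mx, addr0, add0r)
    -scalar_mx_block.
- by move=> v; rewrite !mulmx_block !(mulmx0, mul0mx, mulmx1, mul1mx, addr0, add0r)
    -scalar_mx_block.
Qed.

(** Maximal rank of the differential is minimality of [dim Hom(M, M)]. *)
Lemma hom_minimal_exists (d : 'I_n -> nat) : exists m : arrows k d,
  forall m' : arrows k d, (\rank (diffmx m' m') <= \rank (diffmx m m))%N.
Proof.
have [|r [[m mr] rmin]] := @nat_least (fun r => exists m : arrows k d,
  r = (#|{: {v : 'I_n & 'I_(d v) * 'I_(d v)}%type}| - \rank (diffmx m m))%N).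
  by eexists; exists (fun a => 0).
exists m => m'; have := rmin _ (ex_intro _ m' erefl); rewrite mr.
have := rank_leq_row (diffmx m m); have := rank_leq_row (diffmx m' m').
by move=> lt' lt; rewrite leq_sub2lE.
Qed.

(** Take [M] with [dim Hom(M, M)] minimal. If [M] is not indecomposable, there are
    no extensions between two complementary summands, and by induction both can be
    replaced by rigid representations of the same dimensions. *)
Lemma rigid_exists (d : 'I_n -> nat) : exists m : arrows k d,
  ext_vanishes (Rep m) (Rep m).
Proof.
have [D] := ubnP (\sum_v d v)%N; elim: D d => // D IH d; rewrite ltnS => dD.
have [m mmax] := hom_minimal_exists d.
case: (pselect (rep_indecomposable (Rep m))) => [/indecomposable_rigid|nind]; first by exists m.
case: (pselect (rep_nonzero (Rep m))) => [nz|/forallNP d0]; last first.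
  exists m => z; exists (fun v => 0) => a; rewrite mulmx0 mul0mx subrr.
  have /negP/negPn/eqP e := d0 (src a).
  by apply/matrixP => i j; have := leq_trans (ltn_ord i) (eq_leq e); rewrite ltn0.
have [W1 [W2 [iso W10 W20]]] : exists W1 W2,
    [/\ rep_iso (Rep m) (rep_sum W1 W2), rep_nonzero W1 & rep_nonzero W2].
  apply: contrapT => nW; apply: nind; split=> // W1 W2 iso [? ?]; apply: nW.
  by exists W1, W2.
have e12 := hom_minimal_ext mmax iso.
have e21 := hom_minimal_ext mmax (rep_iso_trans iso (rep_sumC W1 W2)).
have dE v : d v = (rdim W1 v + rdim W2 v)%N by exact: rep_iso_dim iso.
have dT : (\sum_v d v = total_dim W1 + total_dim W2)%N.
  by rewrite -big_split; apply: eq_bigr => v _; exact: dE.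
move: (W10) (W20) => /rep_nonzeroP W1p /rep_nonzeroP W2p.
have [|m1 r1] := IH (rdim W1); first by rewrite -/(total_dim W1); lia.
have [|m2 r2] := IH (rdim W2); first by rewrite -/(total_dim W2); lia.
have r12 := rigid_ext_vanishes (M := Rep m1) (N := Rep m2) (A := W1) (B := W2) (fun=>
    erefl) (fun=> erefl) r1 r2 e12.
have r21 := rigid_ext_vanishes (M := Rep m2) (N := Rep m1) (A := W2) (B := W1) (fun=>
    erefl) (fun=> erefl) r2 r1 e21.
have [|x xE] := @rep_cast _ _ _ d (rep_sum (Rep m1) (Rep m2)); first by move=> v; rewrite dE.
exists x; rewrite -xE; apply: ext_vanishes_suml; exact: ext_vanishes_sumr.
Qed.

End TitsForm.

(** * Schur roots and the canonical decomposition *)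
Section CanonicalDecomposition.

Variables (n : nat) (Q : quiver n) (k : closedFieldType).
Hypothesis pos : tits_positive Q.
Local Notation rep := (representation k Q).
Local Notation arrows R d := (forall a : arrow Q, 'M[R]_(d (src a), d (tgt a))).
Implicit Types (A B C M N W X Y : rep) (beta : dimvector n).

Lemma dimvecE M beta v : dimvec M = beta -> rdim M v = beta v.
Proof. by move=> <-; rewrite ffunE. Qed.

(** The minimum in [ext_dim] is attained. *)
Lemma ext_dim_eq0 beta beta' : ext_dim k Q beta beta' = 0%N <->
  exists A B, [/\ dimvec A = beta, dimvec B = beta' & ext_vanishes A B].
Proof.
rewrite /ext_dim; case: ex_minnP => m /asboolP[A [B [dA dB e]]] mmin; split.
  by move=> m0; exists A, B; split=> //; apply/ext_vanishesP; rewrite e.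
move=> [A' [B' [dA' dB' /ext_vanishesP e']]]; apply/eqP; rewrite -leqn0.
by apply: mmin; apply/asboolP; exists A', B'.
Qed.

Lemma rigid_ext_dim A B beta beta' : dimvec A = beta -> dimvec B = beta' ->
  ext_vanishes A A -> ext_vanishes B B -> ext_dim k Q beta beta' = 0%N ->
  ext_vanishes A B.
Proof.
move=> dA dB rA rB /ext_dim_eq0[A' [B' [dA' dB' e]]].
apply: (@rigid_ext_vanishes _ _ _ A B A' B') => // v.
  by rewrite (dimvecE v dA') (dimvecE v dA).
by rewrite (dimvecE v dB') (dimvecE v dB).
Qed.

Lemma rigid_dimvec_iso M N : dimvec M = dimvec N ->
  ext_vanishes M M -> ext_vanishes N N -> rep_iso M N.
Proof.
move=> dE; apply: rigid_iso => v.
by rewrite (dimvecE v dE) ffunE.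
Qed.

Definition coords (d : dimvector n) (x : arrows k d) : rep_space k Q d :=
  [ffun c => x (tag c) (tagged c).1 (tagged c).2].

Lemma rep_of_coords (d : dimvector n) (x : arrows k d) : rep_of (coords x) = Rep x.
Proof.
rewrite /rep_of; congr Rep; apply/functional_extensionality_dep => a.
by apply/matrixP => i j; rewrite !mxE ffunE.
Qed.

Definition arrows_of (d : dimvector n) (x : rep_space k Q d) : arrows k d :=
  fun a => \matrix_(i, j)
    x (Tagged (fun a => 'I_(d (src a)) * 'I_(d (tgt a)))%type (i, j)).

(** A polynomial that does not vanish at [y] is a nonzero polynomial on the
    line from [x] to [y]. *)
Lemma mpoly_line (N : nat) (p : mpoly.mpoly N k) (x y : 'I_N -> k) :
  exists q : {poly k}, forall s, q.[s] = mpoly.meval (fun i => x i + s * (y i - x i)) p.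
Proof.
exists (\sum_(m <- mpoly.msupp p) (mpoly.mcoeff m p)%:P *
  \prod_i ((x i)%:P + 'X * (y i - x i)%:P) ^+ mpoly.fun_of_multinom m i) => s.
rewrite mpoly.mevalE horner_sum; apply: eq_bigr => m _.
rewrite hornerM hornerC horner_prod; congr (_ * _); apply: eq_bigr => i _.
by rewrite horner_exp !hornerE.
Qed.

(** The representation over the polynomial ring whose matrix entries are the
    coordinate functions of [rep_space]. *)
Definition generic_arrows (d : dimvector n) :
    arrows (mpoly.mpoly #|{: rep_coord Q d}| k) d :=
  fun a => \matrix_(i, j) mpoly.mpolyX k (mpoly.mnm1 (enum_rank
    (Tagged (fun a => 'I_(d (src a)) * 'I_(d (tgt a)))%type (i, j)))).

Lemma generic_arrowsE (d : dimvector n) (x : rep_space k Q d) :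
  (fun a => map_mx (mpoly.meval (fun i => x (enum_val i))) (generic_arrows d a)) =
  arrows_of x.
Proof.
apply/functional_extensionality_dep => a; apply/matrixP => i j.
by rewrite !mxE mpoly.mevalXU enum_rankK.
Qed.

(** A nonempty Zariski open set meets the set of representations isomorphic to
    the rigid representation of that dimension, on the line through a point of
    each; conversely the representations isomorphic to a rigid [M] contain
    a principal open set. *)
Lemma schur_rootP beta : schur_root k Q beta <->
  exists M, dimvec M = beta /\ rep_indecomposable M.
Proof.
split=> [[U [[S SE] [x Ux] Ui]]|[M [dM Mi]]].
  have [m mr] := rigid_exists pos k beta.
  exists (Rep m); split; first by apply/ffunP => v; rewrite ffunE.
  have [p [Sp px]] : exists p, S p /\ mpoly.meval (fun i => x (enum_val i)) p != 0.
    apply: contrapT => np; have : (~` U) x; last exact.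
    rewrite SE => p Sp; apply: contrapT => /eqP px; apply: np; by exists p.
  have [q qE] := mpoly_line p (fun i => coords m (enum_val i)) (fun i => x (enum_val i)).
  have q1 : q.[1] = mpoly.meval (fun i => x (enum_val i)) p.
    rewrite qE; congr mpoly.meval; apply/functional_extensionality_dep => i.
    by rewrite mul1r addrC subrK.
  have [|F [F1 FE]] := rigid_iso_open (X := pencil m (arrows_of x)) (specialization_horner 0).
    by rewrite pencil0.
  have [|s] := @poly_nonroot _ (F * q).
    rewrite mulf_neq0 //; apply/eqP => z.
      by move: F1; rewrite z rmorph0 => /eqP; rewrite eq_sym oner_eq0.
    by move: px; rewrite -q1 z horner0 eqxx.
  rewrite hornerM mulf_eq0 negb_or => /andP[Fs qs].
  have := FE _ (specialization_horner s) Fs; rewrite pencil0.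
  pose y : arrows k beta := fun a => map_mx (horner_eval s) (pencil m (arrows_of x) a).
  move=> iso; apply: (@rep_iso_indecomposable _ _ _ (Rep y) (Rep m)).
    exact: rep_iso_sym iso.
  rewrite -rep_of_coords; apply: Ui; apply: contrapT => nU.
  have : (~` U) (coords y) by [].
  rewrite SE => /(_ p Sp) => e; move: qs; rewrite qE => /eqP; apply.
  rewrite -[RHS]e; congr mpoly.meval; apply/functional_extensionality_dep => i.
  rewrite /coords !ffunE /y pencil_eval !mxE.
  by case: (enum_val i) => a [i1 i2].
have [m mE] := rep_cast (fun v => dimvecE v dM).
move: dM Mi; rewrite {}mE {M} => _ Mi.
have rm := indecomposable_rigid pos Mi.
have evC (v : 'I_#|{: rep_coord Q beta}| -> k) :
    specialization (@mpoly.mpolyC #|{: rep_coord Q beta}| k) (mpoly.meval v).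
  by move=> c; exact: mpoly.mevalC.
have mE : (fun a => map_mx (mpoly.meval (fun i => coords m (enum_val i)))
    (generic_arrows beta a)) = m.
  rewrite generic_arrowsE; apply/functional_extensionality_dep => a.
  by apply/matrixP => i j; rewrite mxE ffunE.
have [|F [F1 FE]] := rigid_iso_open (X := generic_arrows beta)
  (evC (fun i => coords m (enum_val i))).
  by rewrite mE.
exists [set x | mpoly.meval (fun i => x (enum_val i)) F != 0]; split.
- exists [set F]; apply/seteqP; split=> x /=.
    by move=> /negP/negPn/eqP e p ->.
  by move=> /(_ F erefl) ->; rewrite eqxx.
- by exists (coords m); rewrite /= F1 oner_neq0.
- move=> x /= Fx; have := FE _ (evC _) Fx.
  rewrite mE generic_arrowsE => iso.
  exact: rep_iso_indecomposable iso Mi.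
Qed.

(** Recording that all terms are summands of [M] is enough to control the
    extensions between them. *)
Lemma indecomposable_decomposition M : exists s : seq (dimvector n),
  (forall beta, beta \in s -> exists B, [/\ rep_indecomposable B, summand B M & dimvec B
      = beta])
  /\ forall v, rdim M v = (\sum_(beta <- s) beta v)%N.
Proof.
have [D] := ubnP (total_dim M); elim: D M => // D IH M; rewrite ltnS => MD.
case: (pselect (rep_indecomposable M)) => [Mi|nind].
  exists [:: dimvec M]; split.
    move=> beta; rewrite inE => /eqP ->; exists M; split=> //.
    by exists (fun v => 1%:M), (fun v => 1%:M); split=> [| |v]; try exact: rep_morph_id;
        rewrite mulmx1.
  by move=> v; rewrite big_seq1 ffunE.
case: (pselect (rep_nonzero M)) => [nz|/forallNP d0]; last first.
  exists [::]; split=> // v; rewrite big_nil; exact/eqP/negPn/negP/d0.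
have [W1 [W2 [iso W10 W20]]] : exists W1 W2,
    [/\ rep_iso M (rep_sum W1 W2), rep_nonzero W1 & rep_nonzero W2].
  apply: contrapT => nW; apply: nind; split=> // W1 W2 iso [? ?]; apply: nW.
  by exists W1, W2.
have dE v : rdim M v = (rdim W1 v + rdim W2 v)%N by exact: rep_iso_dim iso.
have dT : (total_dim M = total_dim W1 + total_dim W2)%N.
  by rewrite -big_split; apply: eq_bigr => v _; exact: dE.
move: (W10) (W20) => /rep_nonzeroP W1p /rep_nonzeroP W2p.
have [|s1 [s1E d1]] := IH W1; first lia.
have [|s2 [s2E d2]] := IH W2; first lia.
have sM W : summand W (rep_sum W1 W2) -> summand W M.
  move=> sW; apply: summand_trans sW _; exact/rep_iso_summand/rep_iso_sym.
exists (s1 ++ s2); split=> [beta|v]; last by rewrite big_cat dE d1 d2.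
rewrite mem_cat => /orP[/s1E|/s2E] [B [Bi sB dB]]; exists B; split=> //; apply: sM.
  exact: summand_trans sB (summand_suml _ _).
exact: summand_trans sB (summand_sumr _ _).
Qed.

(** The condition on the roots of a partial virtual semi-tilting set, for a list
    in which repetitions serve as multiplicities. *)
Definition compatible (s : seq (dimvector n)) : Prop :=
  (forall beta, beta \in s -> schur_root k Q beta) /\
  (forall beta beta', beta \in s -> beta' \in s -> beta <> beta' ->
     ext_dim k Q beta beta' = 0%N).

Lemma canonical_decomposition_exists (d : 'I_n -> nat) : exists s,
  compatible s /\ forall v, d v = (\sum_(beta <- s) beta v)%N.
Proof.
have [m mr] := rigid_exists pos k d.
have [s [sE dE]] := indecomposable_decomposition (Rep m).
exists s; split=> //; split=> [beta /sE[B [Bi _ dB]]|beta beta' /sE[B [_ sB dB]] /sE[B'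
    [_ sB' dB']] _].
  by apply/schur_rootP; exists B.
apply/ext_dim_eq0; exists B, B'; split=> //.
exact: ext_vanishes_summand mr.
Qed.

(** The identity of [C] is the sum of its two components through [X] and [Y], which
    are scalars; a nonzero one splits [C] off. *)
Lemma brick_summand_sum C X Y : rep_nonzero C -> brick C ->
  summand C (rep_sum X Y) -> summand C X \/ summand C Y.
Proof.
move=> [v0 Cv0] Cb [i [p [im pm ip]]].
have [i1 [i2 [p1 [p2 [[im1 im2 pm1 pm2] [_ _ _ _ e]]]]]] := rep_sum_biproduct X Y.
have key Z (j : forall v, 'M[k]_(rdim Z v, rdim (rep_sum X Y) v)) q c :
    rep_morph j -> rep_morph q ->
    (forall v, comp_fam (comp_fam i q) (comp_fam j p) v = c%:M) ->
    c != 0 -> summand C Z.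
  move=> jm qm cE c0; exists (comp_fam i q), (fun v => c^-1 *: comp_fam j p v); split.
  - exact: rep_morph_comp.
  - have jpm := rep_morph_comp jm pm.
    by move=> a; rewrite -scalemxAr jpm scalemxAl.
  - by move=> v; rewrite -scalemxAr [_ *m _]cE scale_scalar_mx mulVf.
have [c1 c1E] : exists c, forall v, comp_fam (comp_fam i p1) (comp_fam i1 p) v = c%:M.
  by apply: Cb; apply: rep_morph_comp; exact: rep_morph_comp.
have [c2 c2E] : exists c, forall v, comp_fam (comp_fam i p2) (comp_fam i2 p) v = c%:M.
  by apply: Cb; apply: rep_morph_comp; exact: rep_morph_comp.
have [c10|c1n] := eqVneq c1 0; last by left; exact: key c1E c1n.
have [c20|c2n] := eqVneq c2 0; last by right; exact: key c2E c2n.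
exfalso; move: (c1E v0) (c2E v0); rewrite c10 c20 => z1 z2.
have : (1%:M : 'M[k]_(rdim C v0)) = 0.
  rewrite -ip -[i v0]mulmx1 -e mulmxDr mulmxDl.
  move: z1 z2; rewrite /comp_fam !mulmxA => -> ->.
  by rewrite raddf0 addr0.
by move/eqP; rewrite -mxrank_eq0 mxrank1 (negPf Cv0).
Qed.

(** The direct sum of the indecomposables attached to the roots in [s]. Its rigidity
    is obtained from lifting properties of the partial sums, so that no
    decomposition of the sum has to be manipulated. *)
Lemma compatible_rigid_sum s : compatible s -> exists M,
  [/\ forall v, rdim M v = (\sum_(beta <- s) beta v)%N,
      ext_vanishes M M,
      forall beta, beta \in s -> exists B, [/\ rep_indecomposable B, summand B M & dimvec
          B = beta] &
      forall C, rep_nonzero C -> brick C -> summand C M -> dimvec C \in s].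
Proof.
case=> sch cmp.
pose root_rep beta B := dimvec B = beta /\ rep_indecomposable B.
pose built (t : seq (dimvector n)) M := [/\ forall v, rdim M v = (\sum_(beta <- t) beta v)%N,
      forall beta, beta \in t -> exists B, [/\ rep_indecomposable B, summand B M & dimvec
          B = beta],
      forall C, rep_nonzero C -> brick C -> summand C M -> dimvec C \in t &
      forall N, (forall beta B, beta \in t -> root_rep beta B -> ext_vanishes N B) ->
          ext_vanishes N M] /\
      forall N, (forall beta B, beta \in t -> root_rep beta B -> ext_vanishes B N) ->
          ext_vanishes M N.
have [M [[dM sM cM lM] rM]] : exists M, built s M.
  have : forall beta, beta \in s -> schur_root k Q beta by [].
  elim: s {sch cmp} => [|beta t IH] sch.
    exists (Rep (rdim := fun=> 0%N) (fun a => 0)); split; first split => //=.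
    - by move=> v; rewrite big_nil.
    - by move=> C [v /negP C0] _ sC; exfalso; apply: C0; rewrite -leqn0; exact:
        (summand_dim v sC).
    - by move=> N _ z; exists (fun v => 0) => a; apply/matrixP => i [].
    - by move=> N _ z; exists (fun v => 0) => a; apply/matrixP => -[].
  have [|M [[dM sM cM lM] rM]] := IH; first by move=> b bt; apply: sch; rewrite inE bt orbT.
  have [B [dB Bi]] := (schur_rootP beta).1 (sch _ (mem_head _ _)).
  exists (rep_sum B M); split; first split.
  - by move=> v; rewrite big_cons /= dM (dimvecE v dB).
  - move=> b; rewrite inE => /orP[/eqP ->|/sM[B' [Bi' sB' dB']]].
      by exists B; split=> //; exact: summand_suml.
    by exists B'; split=> //; apply: summand_trans sB' (summand_sumr _ _).
  - move=> C Cn Cb sC; rewrite inE; case: (brick_summand_sum Cn Cb sC) => [CB|CM].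
      apply/orP; left; apply/eqP; rewrite -dB; apply/ffunP => v; rewrite !ffunE.
      exact: indecomposable_summand.
    by rewrite cM ?orbT.
  - move=> N NB; apply: ext_vanishes_sumr; first by apply: (NB beta); rewrite ?mem_head.
    by apply: lM => b B' bt; apply: NB; rewrite inE bt orbT.
  - move=> N NB; apply: ext_vanishes_suml; first by apply: (NB beta); rewrite ?mem_head.
    by apply: rM => b B' bt; apply: NB; rewrite inE bt orbT.
exists M; split=> //; apply: rM => b B bs [dB Bi]; apply: lM => b' B' bs' [dB' Bi'].
have [rB rB'] := (indecomposable_rigid pos Bi, indecomposable_rigid pos Bi').
have [bb|/eqP bb] := eqVneq b b'.
  have iso : rep_iso B B' by apply: rigid_dimvec_iso; rewrite ?dB ?dB'.
  exact: ext_vanishes_iso (rigid_dimvec_iso erefl rB rB) iso rB.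
by apply: rigid_ext_dim dB dB' rB rB' _; exact: cmp.
Qed.

(** The two sums are isomorphic, being rigid with the same dimensions. *)
Lemma canonical_decomposition_unique s s' : compatible s -> compatible s' ->
  (forall v, (\sum_(beta <- s) beta v = \sum_(beta <- s') beta v)%N) ->
  {subset s <= s'}.
Proof.
move=> /compatible_rigid_sum[M [dM rM sM _]] /compatible_rigid_sum[M' [dM' rM' _ cM']]
    ss' beta bs.
have [B [Bi sB <-]] := sM beta bs.
have iso : rep_iso M M' by apply: rigid_iso => // v; rewrite dM dM' ss'.
apply: cM'; first exact: Bi.1.
  exact: (indecomposable_brick (brick_rigid pos (k := k))).
exact: summand_trans sB (rep_iso_summand iso).
Qed.

End CanonicalDecomposition.

(** * Positivity of the Tits form of a Dynkin quiver *)
Section Dynkin.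

(** The quadratic form of a chain of [m] vertices attached to a vertex with
    coordinate [y m], corrected by the multiple of [(y m)^2] that makes it
    semidefinite. *)
Definition arm (y : nat -> rat) (m : nat) : rat :=
  \sum_(i < m) (y i ^+ 2 - y i * y i.+1) + m%:R / (2 * m.+1%:R) * y m ^+ 2.

(** Completion of the square at the new end of the chain. *)
Lemma armS y m : arm y m.+1 = arm y m +
  m.+2%:R / (2 * m.+1%:R) * (y m - m.+1%:R / m.+2%:R * y m.+1) ^+ 2.
Proof.
rewrite /arm big_ord_recr /= -!natr1.
have h : (m%:R : rat) >= 0 by rewrite ler0n.
field; do ?[apply/andP; split]; apply/eqP => e; lra.
Qed.

Lemma arm_ge0 y m : 0 <= arm y m.
Proof.
elim: m => [|m IH]; first by rewrite /arm big_ord0 add0r mulr0n !mul0r.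
by rewrite armS addr_ge0 // mulr_ge0 ?sqr_ge0 // divr_ge0 ?ler0n ?mulr_ge0 ?ler0n.
Qed.

Lemma arm_eq0 y m : arm y m = 0 -> y m = 0 -> forall i, (i <= m)%N -> y i = 0.
Proof.
elim: m => [|m IH] a0 ym i; first by rewrite leqn0 => /eqP ->.
rewrite leq_eqVlt => /orP[/eqP -> //|]; rewrite ltnS; apply: IH.
  apply/eqP; rewrite eq_le arm_ge0 andbT -a0 armS lerDl.
  by rewrite mulr_ge0 ?sqr_ge0 // divr_ge0 ?ler0n // mulr_ge0 ?ler0n.
move: a0; rewrite armS ym mulr0 subr0 => /eqP.
have p0 : 0 < m.+2%:R / (2 * m.+1%:R) :> rat by rewrite divr_gt0 ?ltr0n // mulr_gt0 ?ltr0n.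
rewrite (paddr_eq0 (arm_ge0 _ _) (mulr_ge0 (ltW p0) (sqr_ge0 _))) => /andP[_].
by rewrite mulf_eq0 (gt_eqF p0) /= sqrf_eq0 => /eqP.
Qed.

Lemma sum_pick (N i : nat) (F : nat -> rat) :
  \sum_(j < N) (i == j)%:R * F j = (i < N)%:R * F i.
Proof.
case: ltnP => iN.
  rewrite (bigD1 (Ordinal iN)) //= eqxx big1 ?addr0 // => j ji.
  by rewrite [i == j]eq_sym -(inj_eq val_inj) /= in ji *; rewrite (negPf ji) mul0r.
rewrite mul0r big1 // => j _.
by rewrite gtn_eqF ?mul0r // (leq_trans (ltn_ord j)).
Qed.

Definition edge_form (X : dynkin_type) (n : nat) (y : nat -> rat) : rat :=
  \sum_(i < n) y i ^+ 2 - \sum_(i < n) \sum_(j < n) (dynkin_edge X n i j)%:R * (y i * y j).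

Lemma edge_formA n y : (forall i, (n <= i)%N -> y i = 0) ->
  edge_form DynkinA n y = arm y n.
Proof.
move=> y0; rewrite /edge_form /arm (y0 n) // expr0n mulr0 addr0 sumrB; congr (_ - _).
apply: eq_bigr => i _ /=; rewrite (sum_pick n i.+1 (fun j => y i * y j)).
by case: ltnP => [|/y0 ->]; rewrite ?mul1r ?mulr0.
Qed.

(** With arms of lengths [c], [r] and 1 at the branch vertex, completing the
    squares leaves a multiple of the square of its coordinate. *)
Lemma branched_form c r (y : nat -> rat) :
  \sum_(i < (c + r).+2) y i ^+ 2 -
  \sum_(i < (c + r).+2) \sum_(j < (c + r).+2) (branched_edge (c + r).+2 c i j)%:R * (y i
      * y j) =
  arm y c + arm (fun i => y (c + r - i)%N) r + (y (c + r).+1 - y c / 2) ^+ 2 +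
  (3 / 4 - c%:R / (2 * (c%:R + 1)) - r%:R / (2 * (r%:R + 1))) * y c ^+ 2.
Proof.
have -> : \sum_(i < (c + r).+2) \sum_(j < (c + r).+2) (branched_edge (c + r).+2 c i j)%:R
    * (y i * y j)
  = \sum_(i < c + r) y i * y i.+1 + y c * y (c + r).+1.
  transitivity (\sum_(i < (c + r).+2) ((i.+1 < (c + r).+1)%N%:R * (y i * y i.+1)
    + (c == i)%:R * (y i * y (c + r).+1))).
    apply: eq_bigr => i _.
    rewrite -(sum_pick (c + r).+1 i.+1 (fun j => y i * y j)) big_ord_recr /=.
    congr (_ + _).
      apply: eq_bigr => j _; rewrite /branched_edge /= ltn_ord andbT.
      by rewrite (ltn_eqF (ltn_ord j)) andbF orbF.
    by rewrite /branched_edge /= ltnn andbF eqxx andbT [_ == c]eq_sym.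
  rewrite big_split /= (sum_pick _ c (fun i => y i * y (c + r).+1)) ltnS.
  rewrite leqW ?leq_addr // mul1r; congr (_ + _).
  rewrite !big_ord_recr /= !ltnS ltnn ltnNge leqnSn !mul0r !addr0.
  by apply: eq_bigr => i _; rewrite ltnS ltn_ord mul1r.
have reindex_arm (F : nat -> rat) : \sum_(i < r) F i = \sum_(i < r) F (r - i.+1)%N.
  by rewrite (reindex_inj rev_ord_inj).
rewrite /arm !sumrB big_ord_recr -addSn big_split_ord big_ord_recr /=.
rewrite [\sum_(i < c + r) _]big_split_ord /=.
rewrite (reindex_arm (fun i => y (c.+1 + i)%N ^+ 2)) (reindex_arm (fun i => y (c + i)%N *
    y (c + i).+1)).
have -> : \sum_(i < r) y (c.+1 + (r - i.+1))%N ^+ 2 = \sum_(i < r) y (c + r - i)%N ^+ 2.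
  by apply: eq_bigr => i _; congr (y _ ^+ 2); have := ltn_ord i; lia.
have -> : \sum_(i < r) y (c + (r - i.+1))%N * y (c + (r - i.+1)).+1 =
  \sum_(i < r) y (c + r - i)%N * y (c + r - i.+1)%N.
  apply: eq_bigr => i _; rewrite mulrC; congr (y _ * y _); have := ltn_ord i; lia.
rewrite addnK.
rewrite -[c.+1%:R]natr1 -[r.+1%:R]natr1.
by field; rewrite !natr1 !pnatr_eq0.
Qed.

Lemma branched_form_gt0 c r (y : nat -> rat) :
  0 < 3 / 4 - c%:R / (2 * (c%:R + 1)) - r%:R / (2 * (r%:R + 1)) :> rat ->
  (exists i, (i < (c + r).+2)%N /\ y i != 0) ->
  0 < \sum_(i < (c + r).+2) y i ^+ 2 -
  \sum_(i < (c + r).+2) \sum_(j < (c + r).+2) (branched_edge (c + r).+2 c i j)%:R * (y i * y j).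
Proof.
move=> g0 [i [ir yi]]; rewrite branched_form lt_def.
have ge0 : 0 <= arm y c + arm (fun i => y (c + r - i)%N) r by rewrite addr_ge0 ?arm_ge0.
have ge0' : 0 <= arm y c + arm (fun i => y (c + r - i)%N) r + (y (c + r).+1 - y c / 2) ^+ 2.
  by rewrite addr_ge0 ?sqr_ge0.
have ge0'' := mulr_ge0 (ltW g0) (sqr_ge0 (y c)).
rewrite (addr_ge0 ge0' ge0'') andbT.
apply: contra_neq yi => /eqP.
rewrite (paddr_eq0 ge0' ge0'') mulf_eq0 (gt_eqF g0) /= sqrf_eq0.
rewrite paddr_eq0 ?sqr_ge0 // paddr_eq0 ?arm_ge0 // => /andP[/andP[/andP[/eqP a1 /eqP a2]
    e]] /eqP yc.
move: e; rewrite yc mul0r subr0 sqrf_eq0 => /eqP e.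
move: ir; rewrite ltnS leq_eqVlt => /orP[/eqP ->//|]; rewrite ltnS => ir.
case: (leqP i c) => ic; first exact: (arm_eq0 a1 yc).
have /= := arm_eq0 a2 _ (i := (c + r - i)%N); rewrite addnK subKn //; apply=> //; lia.
Qed.

(** Type D: arms of lengths 1, 1 and [q]. *)
Lemma coefD_gt0 (q : rat) : 0 <= q ->
  0 < 3 / 4 - 1 / (2 * (1 + 1)) - q / (2 * (q + 1)).
Proof.
move=> q0; have -> : 3 / 4 - 1 / (2 * (1 + 1)) - q / (2 * (q + 1)) = 1 / (2 * (q + 1)).
  by field; apply/eqP => e; lra.
by rewrite divr_gt0 //; lra.
Qed.

(** Type E: arms of lengths 1, 2 and [q]; the coefficient vanishes at [q = 5], the
    affine diagram of E_8. *)
Lemma coefE_gt0 (q : rat) : 0 <= q -> q <= 4 ->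
  0 < 3 / 4 - 2 / (2 * (2 + 1)) - q / (2 * (q + 1)).
Proof.
move=> q0 q4; have -> : 3 / 4 - 2 / (2 * (2 + 1)) - q / (2 * (q + 1)) = (5 - q) / (12 *
    (q + 1)).
  by field; apply/eqP => e; lra.
by rewrite divr_gt0 //; lra.
Qed.

Lemma edge_form_gt0 X n y : dynkin_rank X n -> (forall i, (n <= i)%N -> y i = 0) ->
  (exists i, (i < n)%N /\ y i != 0) -> 0 < edge_form X n y.
Proof.
move=> rk y0 yn; case: X rk => /= rk.
- rewrite edge_formA // lt_def arm_ge0 andbT; case: yn => i [ni yi].
  by apply: contra_neq yi => /arm_eq0; apply; [exact: y0|exact: ltnW].
- have nE : n = (1 + (n - 3)).+2 by lia.
  move: yn; rewrite /edge_form nE => yn; apply: branched_form_gt0 yn.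
  exact: coefD_gt0 (ler0n _ _).
- have nE : n = (2 + (n - 4)).+2 by lia.
  have r4 : (n - 4 <= 4)%N by lia.
  move: yn; rewrite /edge_form nE => yn; apply: branched_form_gt0 yn.
  by apply: coefE_gt0; [exact: ler0n|rewrite ler_nat].
Qed.

Lemma dynkin_edge_lt X n i j : (0 < n)%N -> dynkin_rank X n -> (i < n)%N ->
  dynkin_edge X n i j -> (i < j)%N.
Proof.
move=> n0 rk ni; case: X rk => /=; first by move=> _ /eqP <-.
- by move=> rk /orP[/andP[/eqP <-]//|/andP[/eqP -> /eqP ->]]; lia.
- by move=> rk /orP[/andP[/eqP <-]//|/andP[/eqP -> /eqP ->]]; lia.
Qed.

(** Twice the Tits form is compared with twice the form of the diagram, because the
    number of arrows between two vertices does not depend on their order. *)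
Lemma dynkin_positive n (Q : quiver n) : dynkin_quiver Q -> tits_positive Q.
Proof.
move=> [X [sigma [rk [tau sK tK] cnt]]] x [v0 xv0].
have n0 : (0 < n)%N by apply: leq_ltn_trans (leq0n v0) (ltn_ord v0).
pose y (i : nat) : rat := if insub i is Some i' then (x (tau i'))%:~R else 0.
have yE (i : 'I_n) : y i = (x (tau i))%:~R by rewrite /y valK.
have y0 i : (n <= i)%N -> y i = 0 by move=> ni; rewrite /y insubN // -leqNgt.
have e0 : 0 < edge_form X n y.
  apply: edge_form_gt0 => //; exists (sigma v0); split; first exact: ltn_ord.
  by rewrite yE sK intr_eq0.
suff e : (tits_form Q x)%:~R *+ 2 = edge_form X n y *+ 2.
  by rewrite -(ltr0z rat) -(pmulrn_lgt0 _ (n := 2)) // e pmulrn_lgt0.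
have inv_edge i j : dynkin_edge X n (sigma i) (sigma j) -> dynkin_edge X n (sigma j)
    (sigma i) = false.
  move=> /(dynkin_edge_lt n0 rk (ltn_ord _)) lt; apply/negP.
  by move=> /(dynkin_edge_lt n0 rk (ltn_ord _)); rewrite ltnNge (ltnW lt).
have noloop (a : arrow Q) : src a != tgt a.
  apply/eqP => l; have := cnt (src a) (src a).
  case E : (dynkin_edge X n (sigma (src a)) (sigma (src a))).
    by have := inv_edge _ _ E; rewrite E.
  move=> /eqP; rewrite /= eqn0Ngt => /negP; apply; apply/card_gt0P; exists a.
  by rewrite inE -l eqxx.
rewrite /tits_form /edge_form rmorphB mulrnBl [RHS]mulrnBl; congr (_ - _).
  congr (_ *+ 2); rewrite rmorph_sum [RHS](reindex sigma) /=; last by apply: onW_bij;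
      exists tau.
  by apply: eq_bigr => v _; rewrite yE sK rmorphXn.
transitivity (\sum_i \sum_j #|[pred a : arrow Q | ((src a == i) && (tgt a == j))
      || ((src a == j) && (tgt a == i))]|%:R * ((x i)%:~R * (x j)%:~R : rat)).
  transitivity (\sum_i \sum_j \sum_(a : arrow Q)
     (((src a == i) && (tgt a == j)) || ((src a == j) && (tgt a == i)))%:R * ((x i)%:~R *
         (x j)%:~R : rat)); last first.
    apply: eq_bigr => i _; apply: eq_bigr => j _.
    rewrite -mulr_suml -sum1_card natr_sum [in RHS]big_mkcond /=; congr (_ * _).
    by apply: eq_bigr => a _; rewrite [in RHS]inE; case: (_ || _).
  under [RHS]eq_bigr do rewrite exchange_big /=.
  rewrite exchange_big /= rmorph_sum -sumrMnl; apply: eq_bigr => a _ /=.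
  rewrite rmorphM (bigD1 (src a)) //= (bigD1 (tgt a)) //= !eqxx mul1r.
  rewrite (bigD1 (tgt a) (P := fun i => i != src a)) /=; last by rewrite eq_sym.
  rewrite (bigD1 (src a) (P := predT)) //= !eqxx orbT mul1r.
  rewrite big1 => [|j jt]; last first.
    by rewrite [tgt a == j]eq_sym (negPf jt) [tgt a == src a]eq_sym (negPf (noloop a))
        !andbF mul0r.
  rewrite big1 => [|j js]; last first.
    by rewrite (negPf (noloop a)) [src a == j]eq_sym (negPf js) mul0r.
  rewrite big1 => [|i /andP[is_ it]]; last first.
    rewrite big1 // => j _.
    by rewrite [src a == i]eq_sym (negPf is_) [tgt a == i]eq_sym (negPf it) andbF mul0r.
  by rewrite !addr0 mulr2n [X in _ + X]mulrC.
pose G i j : rat := (dynkin_edge X n (sigma i) (sigma j))%:R * ((x i)%:~R * (x j)%:~R).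
transitivity (\sum_i \sum_j (G i j + G j i)).
  apply: eq_bigr => i _; apply: eq_bigr => j _; rewrite cnt /G [X in _ + _ * X]mulrC -mulrDl.
  congr (_ * _); case E : (dynkin_edge X n (sigma i) (sigma j)) => /=.
    by rewrite (inv_edge _ _ E) addr0.
  by rewrite add0r.
under eq_bigr do rewrite big_split.
rewrite big_split /= [X in _ + X]exchange_big /= mulr2n.
suff -> : \sum_i \sum_j G i j = \sum_(i < n) \sum_(j < n) (dynkin_edge X n i j)%:R * (y i
    * y j) by [].
rewrite [RHS](reindex sigma) /=; last by apply: onW_bij; exists tau.
apply: eq_bigr => i _; rewrite [RHS](reindex sigma) /=; last by apply: onW_bij; exists tau.
by apply: eq_bigr => j _; rewrite !yE !sK.
Qed.

End Dynkin.

(** * Acyclicity and finiteness of the set of roots *)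
Section Roots.

Variables (n : nat) (Q : quiver n).
Hypothesis pos : tits_positive Q.

(** Otherwise there are at least as many arrows inside [U] as vertices, and the
    Tits form is not positive at the indicator of [U]. *)
Lemma sink_exists (U : {set 'I_n}) : U != finset.set0 ->
  exists2 v, v \in U & forall a : arrow Q, src a = v -> tgt a \notin U.
Proof.
move=> /set0Pn[u uU]; apply: contrapT => nosink.
have succ v : v \in U -> exists a : arrow Q, (src a == v) && (tgt a \in U).
  move=> vU; apply: contrapT => na; apply: nosink; exists v => // a av.
  by apply/negP => aU; apply: na; exists a; rewrite av eqxx.
pose x v : int := (v \in U)%:R.
have : 0 < tits_form Q x by apply: pos; exists u; rewrite /x uU.
apply/negP; rewrite -leNgt /tits_form subr_le0.
pose E : {set arrow Q} := finset (fun a => (src a \in U) && (tgt a \in U)).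
have -> : \sum_(a : arrow Q) x (src a) * x (tgt a) = #|E|%:Z.
  rewrite -sum1_card -natz natr_sum [RHS]big_mkcond /=; apply: eq_bigr => a _.
  by rewrite inE /x; do 2 case: (_ \in U); rewrite ?mulr0 ?mulr1.
have -> : \sum_v x v ^+ 2 = #|U|%:Z.
  rewrite -sum1_card -natz natr_sum [RHS]big_mkcond /=; apply: eq_bigr => a _.
  by rewrite /x; case: (_ \in U).
rewrite lez_nat; apply: leq_trans (leq_imset_card (@src n Q) E).
apply/subset_leq_card/fintype.subsetP => v /[dup] vU /succ[a /andP[/eqP av aU]].
by apply/imsetP; exists a; rewrite ?inE ?av ?vU.
Qed.

(** Remove the sinks one at a time. *)
Lemma height_exists : exists ht : 'I_n -> nat,
  forall a : arrow Q, (ht (src a) < ht (tgt a))%N.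
Proof.
suff H m (U : {set 'I_n}) : #|U| = m -> exists ht : 'I_n -> nat,
    forall a : arrow Q, src a \in U -> tgt a \in U -> (ht (src a) < ht (tgt a))%N.
  have [ht htP] := H _ [set: 'I_n]%SET erefl.
  by exists ht => a; apply: htP; rewrite finset.in_setT.
elim: m U => [|m IH] U cU.
  by exists (fun=> 0%N) => a; rewrite (cards0_eq cU) finset.in_set0.
have [|v vU vs] := @sink_exists U; first by rewrite -card_gt0 cU.
have [|ht htP] := IH (U :\ v)%SET; first by move: cU; rewrite (cardsD1 v) vU => -[].
exists (fun w => if w == v then (\max_w ht w).+1 else ht w) => a aU aU'.
have sv : src a != v by apply/eqP => sv; have := vs a sv; rewrite aU'.
rewrite (negPf sv); case: eqVneq => [_|tv]; first by rewrite ltnS leq_bigmax.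
by apply: htP; rewrite finset.in_setD1 ?sv ?tv.
Qed.

Variable ht : 'I_n -> nat.
Hypothesis htP : forall a : arrow Q, (ht (src a) < ht (tgt a))%N.

Lemma is_path_height v w (s : seq (arrow Q)) : is_path v w s ->
  (s = [::] /\ v = w) \/ (ht v < ht w)%N.
Proof.
elim: s v => [|a s IH] v /=; first by move=> /eqP ->; left.
move=> /andP[/eqP <- /IH[[_ <-]|lt]]; right; first exact: htP.
exact: ltn_trans (htP a) lt.
Qed.

Lemma projective_root_diag (k : fieldType) v : projective_root k Q v v = 1%N.
Proof.
rewrite /projective_root ffunE /= /quiver_path card_sig.
rewrite -(card1 ([bseq] : n.-bseq (arrow Q))); apply: eq_card => s; rewrite !inE;
    apply/idP/eqP => [|->]; last by rewrite /= eqxx.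
by move=> /is_path_height[[e _]|]; [apply: val_inj|rewrite ltnn].
Qed.

Lemma projective_root_triangular (k : fieldType) v w : v <> w -> (ht w <= ht v)%N ->
  projective_root k Q v w = 0%N.
Proof.
move=> vw wv; rewrite /projective_root ffunE /= /quiver_path card_sig.
apply: eq_card0 => s; rewrite !inE; apply/negP => /is_path_height[[_ //]|].
by rewrite ltnNge wv.
Qed.

(** The symmetric bilinear form of the Tits form, at [x] and the simple root of
    [i]. *)
Definition tits_pairing (x : 'I_n -> int) (i : 'I_n) : int :=
  2 * x i - \sum_(a : arrow Q) ((src a == i)%:R * x (tgt a) + (tgt a == i)%:R * x (src a)).

Lemma tits_pairing_sum x : \sum_i x i * tits_pairing x i = 2 * tits_form Q x.
Proof.
rewrite /tits_pairing /tits_form mulrBr [in RHS]mulr_sumr.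
under eq_bigr do rewrite mulrBr.
rewrite sumrB; congr (_ - _); first by apply: eq_bigr => i _; ring.
under eq_bigr do rewrite mulr_sumr.
rewrite exchange_big mulr_sumr; apply: eq_bigr => a _ /=.
rewrite (eq_bigr (fun i => (src a == i)%:R * (x i * x (tgt a)) + (tgt a == i)%:R * (x i *
    x (src a)))); last first.
  by move=> i _; ring.
rewrite big_split /= (bigD1 (src a)) //= eqxx big1 => [|i /negPf ia]; last first.
  by rewrite eq_sym ia mul0r.
rewrite (bigD1 (tgt a)) //= eqxx big1 => [|i /negPf ia]; last first.
  by rewrite eq_sym ia mul0r.
by rewrite !mul1r; ring.
Qed.

Lemma tits_form_addE x (c : int) i :
  tits_form Q (fun v => x v + c * (v == i)%:R) =
  tits_form Q x + c * tits_pairing x i + c ^+ 2 * (1 - \sum_(a : arrow Q) ((src a == i)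
      && (tgt a == i))%:R).
Proof.
rewrite /tits_form /tits_pairing.
have -> : \sum_v (x v + c * (v == i)%:R) ^+ 2 = \sum_v x v ^+ 2 + 2 * c * x i + c ^+ 2.
  rewrite (bigD1 i) //= [in RHS](bigD1 i) //= eqxx.
  rewrite (eq_bigr (fun v => x v ^+ 2)); first by rewrite mulr1; ring.
  by move=> v /negPf ->; rewrite mulr0 addr0.
have -> : \sum_(a : arrow Q) (x (src a) + c * (src a == i)%:R) * (x (tgt a) + c * (tgt a
    == i)%:R)
  = \sum_(a : arrow Q) x (src a) * x (tgt a)
    + c * \sum_(a : arrow Q) ((src a == i)%:R * x (tgt a) + (tgt a == i)%:R * x (src a))
    + c ^+ 2 * \sum_(a : arrow Q) ((src a == i) && (tgt a == i))%:R.
  rewrite !mulr_sumr -!big_split; apply: eq_bigr => a _ /=.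
  by do 2 case: eqP => _ /=; ring.
ring.
Qed.

Lemma tits_form_ge0 x : 0 <= tits_form Q x.
Proof.
have [[v xv]|x0] := pselect (exists v, x v != 0); first by apply/ltW/pos; exists v.
have {}x0 v : x v = 0 by apply/eqP; apply: contrapT => /negP xv; apply: x0; exists v.
rewrite /tits_form !big1 ?subrr // => [a _|v _]; by rewrite x0 ?mul0r ?expr0n.
Qed.

(** For the simple root [e_i], [q(x + e_i)] is positive, [q(x - e_i)] is
    nonnegative, and [q(e_i) <= 1]. *)
Lemma tits_pairing_bounds (d : 'I_n -> nat) i : tits_form Q (fun v => (d v)%:Z) <= 1 ->
  -1 <= tits_pairing (fun v => (d v)%:Z) i <= 2.
Proof.
move=> q1; set x := fun v => (d v)%:Z.
have l0 : 0 <= \sum_(a : arrow Q) ((src a == i) && (tgt a == i))%:R :> int.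
  by apply: sumr_ge0 => a _; case: (_ && _).
have h1 : 0 < tits_form Q (fun v => x v + 1 * (v == i)%:R).
  by apply: pos; exists i; rewrite /x eqxx mulr1 -PoszD addn1.
have h2 := tits_form_ge0 (fun v => x v + (-1) * (v == i)%:R).
move: q1 h1 h2; rewrite -/x !tits_form_addE.
by move: (\sum_(a : arrow Q) _) l0 (tits_form Q x) (tits_pairing x i) => l l0 q p; lia.
Qed.

(** The form is nondegenerate. *)
Lemma tits_pairing_inj x y : (forall i, tits_pairing x i = tits_pairing y i) -> forall i,
    x i = y i.
Proof.
move=> xy; apply: contrapT => /existsNP[i nxy].
pose z v := x v - y v.
have : 0 < tits_form Q z by apply: pos; exists i; rewrite /z subr_eq0; apply/eqP.
suff : 2 * tits_form Q z = 0 by lia.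
rewrite -tits_pairing_sum big1 // => j _.
suff -> : tits_pairing z j = tits_pairing x j - tits_pairing y j by rewrite xy subrr mulr0.
rewrite /tits_pairing.
have -> : \sum_(a : arrow Q) ((src a == j)%:R * z (tgt a) + (tgt a == j)%:R * z (src a)) =
  \sum_(a : arrow Q) ((src a == j)%:R * x (tgt a) + (tgt a == j)%:R * x (src a)) -
  \sum_(a : arrow Q) ((src a == j)%:R * y (tgt a) + (tgt a == j)%:R * y (src a)).
  by rewrite -sumrB; apply: eq_bigr => a _; rewrite /z; ring.
by rewrite /z; ring.
Qed.

(** The pairings with the simple roots take four values and determine the
    vector. *)
Lemma finite_tits_roots : finite_set [set beta : dimvector n | tits_form Q (fun v =>
    (beta v)%:Z) <= 1].
Proof.
pose p (beta : dimvector n) i := tits_pairing (fun v => (beta v)%:Z) i.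
pose f (beta : dimvector n) : {ffun 'I_n -> 'I_4} := [ffun i => inord `|(p beta i + 1)%R|%N].
set A := [set beta | _].
have finj : {in A &, injective f}.
  move=> b c; rewrite !inE /A /= => b1 c1 /ffunP bc; apply/ffunP => v.
  suff : (b v)%:Z = (c v)%:Z by case.
  apply: (tits_pairing_inj (x := fun v => (b v)%:Z) (y := fun v => (c v)%:Z)) => i.
  have := bc i; rewrite !ffunE => /(congr1 val).
  have := tits_pairing_bounds i b1; have := tits_pairing_bounds i c1.
  rewrite -/(p b i) -/(p c i) => hc hb.
  rewrite /= !inordK; lia.
have [h hf] : exists h, forall beta, A beta -> h (f beta) = beta.
  have /choice[h hP] : forall c, exists beta, forall beta', A beta' -> f beta' = c ->
      beta = beta'.
    move=> c; case: (pselect (exists beta, A beta /\ f beta = c)) => [[beta [Ab <-]]|nb].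
      by exists beta => beta' Ab' e; apply: finj; rewrite ?inE.
    by exists [ffun=> 0%N] => beta' Ab' e; exfalso; apply: nb; exists beta'.
  by exists h => beta Ab; exact: hP.
apply: (@sub_finite_set _ _ (h @` [set: {ffun 'I_n -> 'I_4}])).
  by move=> beta Ab; exists (f beta) => //; exact: hf.
exact/finite_image/finite_finset.
Qed.

Lemma finite_schur_roots (k : closedFieldType) : finite_set (schur_root k Q).
Proof.
apply: sub_finite_set finite_tits_roots => beta /(schur_rootP k pos)[M [dM Mi]] /=.
have -> : (fun v => (beta v)%:Z) = (fun v => (rdim M v)%:Z).
  by apply/funext => v; rewrite (dimvecE v dM).
apply: brick_tits_le1; exact: (indecomposable_brick (brick_rigid pos (k := k))).
Qed.

End Roots.

(** * Linear complementarity for a unitriangular matrix *)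
Section Complementarity.

Variables (n : nat) (P : 'I_n -> 'I_n -> nat) (ht : 'I_n -> nat).
Hypothesis P_diag : forall v, P v v = 1%N.
Hypothesis P_tri : forall v w, v <> w -> (ht w <= ht v)%N -> P v w = 0%N.

Lemma triangular_sum (R : pzRingType) (f : 'I_n -> R) w :
  \sum_v f v * (P v w)%:R = f w + \sum_(v | (ht v < ht w)%N) f v * (P v w)%:R.
Proof.
rewrite (bigD1 w) //= P_diag mulr1; congr (_ + _).
rewrite big_mkcond [RHS]big_mkcond; apply: eq_bigr => v _.
case: eqVneq => [->|/eqP vw]; first by rewrite ltnn.
by case: ltnP => // /(P_tri vw) ->; rewrite mulr0.
Qed.

(** Once the coordinates at smaller heights agree, the difference [d w - m w] is
    determined, and [d w], [m w] are its positive and negative parts. *)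
Lemma complementary_unique (R : realDomainType) (d m d' m' : 'I_n -> R) :
  (forall v, 0 <= d v) -> (forall v, 0 <= m v) -> (forall v, d v * m v = 0) ->
  (forall v, 0 <= d' v) -> (forall v, 0 <= m' v) -> (forall v, d' v * m' v = 0) ->
  (forall w, d w - \sum_v m v * (P v w)%:R = d' w - \sum_v m' v * (P v w)%:R) ->
  forall v, d v = d' v /\ m v = m' v.
Proof.
move=> d0 m0 dm d0' m0' dm' e.
suff H N v : (ht v < N)%N -> d v = d' v /\ m v = m' v by move=> v; exact: H (ltnSn _).
elim: N v => // N IH w; rewrite ltnS => hw.
have := e w; rewrite !triangular_sum.
rewrite (eq_bigr (fun v => m' v * (P v w)%:R)); last first.
  by move=> v lt; have [_ ->] := IH v (leq_trans lt hw).
rewrite !opprD !addrA => /addIr.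
have /eqP := dm w; have /eqP := dm' w; rewrite !mulf_eq0.
have := d0 w; have := m0 w; have := d0' w; have := m0' w.
by move=> ? ? ? ? /orP[/eqP ->|/eqP ->] /orP[/eqP ->|/eqP ->] ?; split; lra.
Qed.

(** [m] is built by increasing height, as a negative part at each vertex. *)
Lemma complementary_exists (y : 'I_n -> int) : exists d m : 'I_n -> nat,
  (forall v, d v * m v = 0)%N /\
  forall w, y w = (d w)%:Z - \sum_v (m v)%:Z * (P v w)%:R.
Proof.
suff H N : exists d m : 'I_n -> nat, (forall v, d v * m v = 0)%N /\
    forall w, (ht w < N)%N -> y w = (d w)%:Z - \sum_v (m v)%:Z * (P v w)%:R.
  have [d [m [dm e]]] := H (\max_v ht v).+1; exists d, m; split=> // w.
  by apply: e; rewrite ltnS leq_bigmax.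
elim: N => [|N [d [m [dm e]]]]; first by exists (fun=> 0%N), (fun=> 0%N).
pose r w := y w + \sum_(v | (ht v < ht w)%N) (m v)%:Z * (P v w)%:R.
exists (fun w => if (ht w < N)%N then d w else if r w is Posz p then p else 0%N),
  (fun w => if (ht w < N)%N then m w else if r w is Negz p then p.+1 else 0%N).
split=> [v|w].
  by case: ifP => _; [exact: dm|case: (r v) => p; rewrite ?muln0].
rewrite ltnS => hw; rewrite triangular_sum.
rewrite (eq_bigr (fun v => (m v)%:Z * (P v w)%:R)); last first.
  by move=> v lt; rewrite (leq_trans lt hw).
case: ifP => [lt|nlt]; first by rewrite (e w lt) triangular_sum.
rewrite opprD addrA; apply/eqP; rewrite -subr_eq opprK -/(r w).
by case: (r w) => p; rewrite ?subr0 // NegzE sub0r.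
Qed.

End Complementarity.

(** * Sign patterns of real and rational solutions *)
Section RationalSigns.

Variable R : realType.

Lemma finite_positive_bound (I : finType) (F : I -> R) : (forall i, 0 < F i) ->
  exists2 e : R, 0 < e & forall i, e <= F i.
Proof.
move=> F0; exists (\big[Order.min/1]_i F i).
  by apply/bigmin_gtP; split.
by move=> i; exact: bigmin_le.
Qed.

(** The kernel of a rational matrix is spanned over the reals by rational vectors;
    approximating the coefficients of a combination preserves strict signs. *)
Lemma rational_strict_signs (p q : nat) (A : 'M[rat]_(p, q)) (e : 'rV[R]_p) :
  e *m map_mx ratr A = 0 ->
  exists f : 'rV[rat]_p, f *m A = 0 /\
    forall i, (0 < e 0 i -> 0 < f 0 i) /\ (e 0 i < 0 -> f 0 i < 0).
Proof.
move=> /sub_kermxP; rewrite -map_kermx => /submxP[y yE].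
set K := kermx A in yE.
pose C := 1 + \sum_i \sum_j `|(ratr (K j i) : R)|.
have C0 : 0 < C by rewrite ltr_wpDr // sumr_ge0 // => i _; exact: sumr_ge0.
have [|eps eps0 epsP] := @finite_positive_bound _
  (fun i => if e 0 i == 0 then 1 else `|e 0 i|).
  by move=> i; case: eqVneq => // ei; rewrite normr_gt0.
have eC : 0 < eps / C by rewrite divr_gt0.
have /choice[r rP] : forall j, exists r : rat, `|y 0 j - ratr r| < eps / C.
  move=> j; have [|r] := @rat_in_itvoo R (y 0 j - eps / C) (y 0 j + eps / C).
    by rewrite ltrBlDr -addrA ltrDl addr_gt0.
  by rewrite in_itv /= => /andP[r1 r2]; exists r; rewrite distrC ltr_distl r1 r2.
pose f := (\row_j r j) *m K.
have close i : `|e 0 i - ratr (f 0 i)| < eps.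
  rewrite /f yE !mxE rmorph_sum /= -sumrB.
  apply: le_lt_trans (ler_norm_sum _ _ _) _.
  apply: (@le_lt_trans _ _ (eps / C * \sum_j `|(ratr (K j i) : R)|)).
    rewrite mulr_sumr; apply: ler_sum => j _; rewrite !mxE rmorphM /= -mulrBl normrM.
    by rewrite ler_wpM2r // ltW.
  rewrite -mulrA gtr_pMr // mulrC ltr_pdivrMr // mul1r.
  apply: (@le_lt_trans _ _ (\sum_i \sum_j `|(ratr (K j i) : R)|)).
    rewrite [X in _ <= X](bigD1 i) //= lerDl; apply: sumr_ge0 => i' _; exact: sumr_ge0.
  by rewrite ltrDr.
exists f; split; first by rewrite -mulmxA mulmx_ker mulmx0.
move=> i; have /= := epsP i; have := close i; rewrite ltr_distl => /andP[c1 c2].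
move=> ee; split=> ei; move: ee.
  by rewrite gt_eqF // gtr0_norm // => ee; rewrite -(ltr0q R); lra.
by rewrite lt_eqF // ltr0_norm // => ee; rewrite -(ltrq0 R); lra.
Qed.

Lemma integer_multiple p (f : 'rV[rat]_p) : exists (N : rat) (g : 'I_p -> int),
  0 < N /\ forall i, (g i)%:~R = N * f 0 i.
Proof.
exists (\prod_i (denq (f 0 i))%:~R), (fun i => numq (f 0 i) * \prod_(j | j != i) denq (f 0 j)).
split; first by apply: prodr_gt0 => i _; rewrite ltr0z denq_gt0.
move=> i; rewrite [in RHS](bigD1 i) //= rmorphM rmorph_prod /=.
by rewrite numqE [RHS]mulrC mulrA.
Qed.

(** The coefficients that vanish are kept equal to zero by adding equations to the
    system, the columns of a diagonal matrix. *)
Lemma integral_signs (T : choiceType) (n : nat) (s : seq T) (vec : T -> 'I_n -> nat)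
    (e : T -> R) : uniq s ->
  (forall v, \sum_(b <- s) e b * (vec b v)%:R = 0) ->
  exists g : T -> int,
    (forall v, \sum_(b <- s) g b * (vec b v)%:R = 0) /\
    forall b, b \in s -> [/\ 0 < e b -> 0 < g b, e b < 0 -> g b < 0 & e b = 0 -> g b = 0].
Proof.
move=> us e0; pose p := size s; pose b_ (i : 'I_p) := tnth (in_tuple s) i.
pose A : 'M[rat]_(p, n + p) := row_mx (\matrix_(i, v) (vec (b_ i) v)%:R)
  (diag_mx (\row_i (e (b_ i) == 0)%:R)).
have [|f [fA fP]] := @rational_strict_signs _ _ A (\row_i e (b_ i)).
  rewrite /A map_row_mx mul_mx_row -row_mx0; congr row_mx.
    apply/rowP => v; rewrite !mxE -[RHS](e0 v) [in RHS]big_tnth; apply: eq_bigr => i _.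
    by rewrite !mxE ratr_nat.
  rewrite map_diag_mx mul_mx_diag; apply/matrixP => j i; rewrite !mxE rmorph_nat.
  by case: eqVneq => [->|]; rewrite ?mul0r ?mulr0.
have [N [g [N0 gE]]] := integer_multiple f.
move: fA; rewrite /A mul_mx_row -row_mx0 => /eq_row_mx[fA1 fA2].
have idx b (bs : b \in s) : (index b s < p)%N by rewrite index_mem.
pose G b := if insub (index b s) is Some i then g i else 0.
have GE i : G (b_ i) = g i.
  by rewrite /G /b_ (tnth_nth (b_ i)) /= index_uniq // valK.
exists G; split=> [v|b bs].
  apply: (@intr_inj rat); rewrite rmorph_sum rmorph0 /= big_tnth.
  under eq_bigr => i _.
    rewrite rmorphM /= -/(b_ i) GE gE -mulrA; over.
  rewrite -mulr_sumr; move/rowP/(_ v): fA1; rewrite !mxE.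
  under eq_bigr do rewrite mxE.
  by move=> fA1; under eq_bigr do rewrite mulrz_nat; rewrite fA1 mulr0.
have [i ->] : exists i, b = b_ i.
  by exists (Ordinal (idx b bs)); rewrite /b_ (tnth_nth b) /= nth_index.
rewrite GE -!(ltr_int rat) gE mulr0z.
have [f1 f2] := fP i; rewrite mxE in f1 f2; split.
- by move=> /f1; exact: mulr_gt0.
- by move=> /f2; rewrite pmulr_rlt0.
- move=> ei; apply: (@intr_inj rat); rewrite gE.
  move/rowP/(_ i): fA2; rewrite mul_mx_diag !mxE ei eqxx mulr1 => ->.
  by rewrite mulr0.
Qed.

End RationalSigns.

(** * The cones over the simplices *)
Section Cones.

Lemma big_flatten_nseq (T : eqType) (m F : T -> nat) (s : seq T) :
  (\sum_(b <- flatten [seq nseq (m b) b | b <- s]) F b = \sum_(b <- s) m b * F b)%N.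
Proof.
elim: s => [|a s IH]; first by rewrite !big_nil.
by rewrite /= big_cat big_cons IH big_nseq iter_addn_0 mulnC.
Qed.

Lemma mem_flatten_nseq (T : eqType) (m : T -> nat) (s : seq T) b :
  (b \in flatten [seq nseq (m b) b | b <- s]) = (b \in s) && (0 < m b)%N.
Proof.
elim: s => [|a s IH] //=; rewrite mem_cat inE mem_nseq IH.
by case: eqVneq => [->|] /=; [case: (0 < _)%N; rewrite ?andbF|rewrite andbF].
Qed.

Lemma sum_count_mem (T : eqType) (F : T -> nat) (l s : seq T) : uniq s ->
  {subset l <= s} -> (\sum_(b <- l) F b = \sum_(b <- s) count_mem b l * F b)%N.
Proof.
move=> us; elim: l => [|a l IH] sub; first by rewrite big_nil big1.
rewrite big_cons IH => [|b bl]; last by rewrite sub // inE bl orbT.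
under [RHS]eq_bigr do rewrite /= mulnDl.
rewrite big_split; congr (_ + _)%N.
rewrite (bigD1_seq a) ?sub ?mem_head //= eqxx mul1n.
rewrite big1 ?addn0 // => b /negPf ba; by rewrite eq_sym ba.
Qed.

Variables (R : realType) (n : nat) (Q : quiver n) (k : closedFieldType).
Hypothesis pos : tits_positive Q.

(** Here [e] is the difference of two decompositions of one real vector. Its positive
    and its negative coefficients, replaced by integers of the same signs, give
    two decompositions without a common root of one dimension vector. *)
Lemma real_decomposition_unique (s : seq (dimvector n)) (e : dimvector n -> R) :
  uniq s ->
  compatible Q k [seq b <- s | 0 < e b] -> compatible Q k [seq b <- s | e b < 0] ->
  (forall v, \sum_(b <- s) e b * (b v)%:R = 0) ->
  forall b, b \in s -> e b = 0.
Proof.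
move=> us cp cn e0.
have [g [g0 gP]] := @integral_signs R _ n s (fun (b : dimvector n) v => b v) e us e0.
pose gp b := if g b is Posz p then p else 0%N.
pose gn b := if g b is Negz p then p.+1 else 0%N.
pose sp := flatten [seq nseq (gp b) b | b <- s].
pose sn := flatten [seq nseq (gn b) b | b <- s].
have spP b : b \in sp -> b \in [seq b <- s | 0 < e b].
  rewrite /sp mem_flatten_nseq mem_filter => /andP[bs]; rewrite bs andbT.
  have [_ h2 h3] := gP b bs; rewrite /gp.
  by case: (ltgtP (e b) 0) => [/h2|//|/h3 ->] //; case: (g b).
have snP b : b \in sn -> b \in [seq b <- s | e b < 0].
  rewrite /sn mem_flatten_nseq mem_filter => /andP[bs]; rewrite bs andbT.
  have [h1 _ h3] := gP b bs; rewrite /gn.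
  by case: (ltgtP (e b) 0) => [//|/h1|/h3 ->] //; case: (g b).
have compat s1 s2 : {subset s1 <= s2} -> compatible Q k s2 -> compatible Q k s1.
  move=> s12 [c1 c2]; split=> [b /s12 /c1//|b b' /s12 bs /s12 bs'].
  exact: c2.
have sums v : (\sum_(b <- sp) b v = \sum_(b <- sn) b v)%N.
  rewrite /sp /sn !big_flatten_nseq.
  apply/eqP; rewrite -eqz_nat -subr_eq0; apply/eqP; rewrite -[RHS](g0 v).
  rewrite !(big_morph Posz PoszD (erefl _)) -sumrB; apply: eq_bigr => b _.
  rewrite !PoszM -mulrBl natz; congr (_ * _); rewrite /gp /gn.
  by case: (g b) => p; rewrite ?subr0 // NegzE sub0r.
have sub := canonical_decomposition_unique pos (compat _ _ spP cp) (compat _ _ snP cn) sums.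
have sub' := canonical_decomposition_unique pos (compat _ _ snP cn) (compat _ _ spP cp)
  (fun v => esym (sums v)).
move=> b bs; have [h1 h2 h3] := gP b bs.
case: (ltgtP (e b) 0) => [eb|eb|//]; exfalso.
  have /sub'/spP : b \in sn.
    by rewrite /sn mem_flatten_nseq bs /=; move: (h2 eb); rewrite /gn; case: (g b).
  by rewrite mem_filter ltNge (ltW eb).
have /sub/snP : b \in sp.
  by rewrite /sp mem_flatten_nseq bs /=; move: (h1 eb); rewrite /gp; case: (g b).
by rewrite mem_filter ltNge (ltW eb).
Qed.

Variable roots : seq (dimvector n).
Hypothesis roots_uniq : uniq roots.
Hypothesis rootsP : forall beta, beta \in roots <-> schur_root k Q beta.

Definition vertices : seq (cluster_vertex n) :=
  map inl roots ++ map inr (enum 'I_n).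

Lemma vertices_uniq : uniq vertices.
Proof.
rewrite cat_uniq; apply/and3P; split.
- by rewrite map_inj_uniq // => ? ? [].
- by apply/hasPn => _ /mapP[v _ ->]; apply/negP => /mapP[].
- by rewrite map_inj_uniq ?enum_uniq // => ? ? [].
Qed.

Lemma mem_vertices x : (x \in vertices) = if x is Root beta then beta \in roots else true.
Proof.
rewrite mem_cat; case: x => [beta|v].
  rewrite (mem_map (@inl_inj _ _)); case: (_ \in roots) => //=.
  by apply/negP => /mapP[].
by rewrite (mem_map (@inr_inj _ _)) mem_enum orbT.
Qed.

Lemma fsum_vertices (V : nmodType) (F : cluster_vertex n -> V) :
  (forall x, x \notin vertices -> F x = 0) ->
  \sum_(x \in [set: cluster_vertex n]) F x = \sum_(x <- vertices) F x.
Proof.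
move=> F0; rewrite (fsbigE vertices F vertices_uniq) //; last by move=> x _; exact: F0.
by apply: eq_bigl => x; rewrite in_setT.
Qed.

Lemma sum_vertices (V : nmodType) (F : cluster_vertex n -> V) :
  \sum_(x <- vertices) F x = \sum_(beta <- roots) F (Root beta) + \sum_v F (ShiftedProj v).
Proof. by rewrite big_cat 2!big_map -[in RHS]big_enum. Qed.

Definition realize (t : cluster_vertex n -> R) : 'rV[R]_n :=
  \sum_(x <- vertices) t x *: vertex_vector R k Q x.

Lemma realizeE t w : realize t 0 w =
  \sum_(beta <- roots) t (Root beta) * (beta w)%:R
  - \sum_v t (ShiftedProj v) * (projective_root k Q v w)%:R.
Proof.
rewrite /realize sum_vertices mxE !summxE -sumrN; congr (_ + _).
  by apply: eq_bigr => b _; rewrite !mxE.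
by apply: eq_bigr => v _; rewrite !mxE mulrN.
Qed.

(** [t] is a combination, not normalized, of the vertices of one simplex. The empty
    simplex is allowed and gives the apex. *)
Definition in_cone (t : cluster_vertex n -> R) : Prop :=
  exists2 s, partial_virtual_semi_tilting k Q s &
    (forall x, ~ s x -> t x = 0) /\ (forall x, 0 <= t x).

Lemma in_cone_vertices t x : in_cone t -> x \notin vertices -> t x = 0.
Proof.
move=> [s [_ sr _ _] [t0 _]]; rewrite mem_vertices; case: x => [b nb|//].
by apply: t0 => /sr/rootsP; rewrite (negPf nb).
Qed.

Lemma in_cone_compatible t : in_cone t ->
  compatible Q k [seq b <- roots | 0 < t (Root b)].
Proof.
move=> [s [_ sr se _] [t0 _]].
have sb b : b \in [seq b <- roots | 0 < t (Root b)] -> s (Root b).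
  rewrite mem_filter => /andP[tb _]; apply: contrapT => /t0 tb0.
  by rewrite tb0 ltxx in tb.
by split=> [b /sb/sr//|b b' /sb ? /sb ?]; exact: se.
Qed.

(** Complementarity determines the coefficients of the shifted projectives and the
    sum [d] of the roots, to which uniqueness of real decompositions applies. *)
Lemma realize_inj t t' : in_cone t -> in_cone t' -> realize t = realize t' ->
  forall x, t x = t' x.
Proof.
move=> ct ct' e; have [ht htP] := height_exists pos.
pose d (t : cluster_vertex n -> R) w := \sum_(b <- roots) t (Root b) * (b w)%:R.
pose m (t : cluster_vertex n -> R) v := t (ShiftedProj v).
have d0 u : in_cone u -> forall v, 0 <= d u v.
  by move=> [s _ [_ u0]] v; apply: sumr_ge0 => b _; rewrite mulr_ge0.
have m0 u : in_cone u -> forall v, 0 <= m u v by move=> [s _ [_ u0]] v; exact: u0.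
have dm0 u : in_cone u -> forall v, d u v * m u v = 0.
  move=> [s [_ _ _ sp] [us _]] v.
  case: (pselect (s (ShiftedProj v))) => [sv|/us mv]; last by rewrite /m mv mulr0.
  rewrite /d big1 ?mul0r // => b _.
  case: (pselect (s (Root b))) => [sb|/us ->]; last by rewrite mul0r.
  by rewrite (sp b v) // mulr0.
have dE : forall v, d t v = d t' v /\ m t v = m t' v.
  apply: (@complementary_unique n (fun v w => projective_root k Q v w) ht);
    try by [exact: d0 | exact: m0 | exact: dm0].
  - by move=> v; exact: (projective_root_diag htP).
  - by move=> v w; exact: (projective_root_triangular htP).
  - by move=> w; have := congr1 (fun y : 'rV[R]_n => y 0 w) e; rewrite !realizeE.
move=> x; have [xV|xV] := boolP (x \in vertices); last by rewrite !in_cone_vertices.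
case: x xV => [b|v _]; last exact: (dE v).2.
rewrite mem_vertices => br; apply/eqP; rewrite -subr_eq0; apply/eqP.
apply: (@real_decomposition_unique roots (fun b => t (Root b) - t' (Root b))) => //.
- have [c1 c2] := in_cone_compatible ct.
  have sub b' : b' \in [seq b <- roots | 0 < t (Root b) - t' (Root b)] ->
      b' \in [seq b <- roots | 0 < t (Root b)].
    rewrite !mem_filter => /andP[tb ->]; rewrite andbT.
    by case: ct' => s _ [_ /(_ (Root b'))]; move: tb; lra.
  by split=> [b' /sub/c1//|b' b'' /sub ? /sub ?]; exact: c2.
- have [c1 c2] := in_cone_compatible ct'.
  have sub b' : b' \in [seq b <- roots | t (Root b) - t' (Root b) < 0] ->
      b' \in [seq b <- roots | 0 < t' (Root b)].
    rewrite !mem_filter => /andP[tb ->]; rewrite andbT.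
    by case: ct => s _ [_ /(_ (Root b'))]; move: tb; lra.
  by split=> [b' /sub/c1//|b' b'' /sub ? /sub ?]; exact: c2.
- move=> v; under eq_bigr do rewrite mulrBl.
  by rewrite sumrB; apply/eqP; rewrite subr_eq0; apply/eqP; exact: (dE v).1.
Qed.

(** Split off the negative part by complementarity and take the canonical
    decomposition of the rest; its roots vanish where the sum does. *)
Lemma realize_integral (y : 'I_n -> int) :
  exists2 t, in_cone t & realize t = \row_w (y w)%:~R.
Proof.
have [ht htP] := height_exists pos.
have [d [m [dm yE]]] := complementary_exists
  (fun v => projective_root_diag htP k v) (@projective_root_triangular _ _ _ htP k) y.
have [l [[lr lc] dE]] := canonical_decomposition_exists k pos d.
pose t (x : cluster_vertex n) : R :=
  match x with inl b => (count_mem b l)%:R | inr v => (m v)%:R end.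
exists t.
  pose s : set (cluster_vertex n) :=
    fun x => match x with inl b => b \in l | inr v => m v != 0%N end.
  exists s; last first.
    split=> [[b /negP|v /negP/negPn/eqP e]|[b|v]] /=; try exact: ler0n.
      by rewrite -has_pred1 has_count -leqNgt leqn0 => /eqP ->.
    by rewrite e.
  split.
  - apply: (@sub_finite_set _ _ [set` vertices]); last exact: finite_seq.
    by move=> [b /lr /rootsP br|v _]; rewrite /= mem_vertices.
  - exact: lr.
  - exact: lc.
  - move=> b v /= bl mv; apply/eqP; rewrite -leqn0.
    have := dm v; move/eqP; rewrite muln_eq0 (negPf mv) orbF dE => /eqP <-.
    by rewrite (big_rem b bl) leq_addr.
apply/rowP => w; rewrite realizeE mxE yE rmorphB /= dE; congr (_ - _).
  rewrite (sum_count_mem _ roots_uniq (fun b bl => (rootsP b).2 (lr b bl))).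
  by rewrite -pmulrn natr_sum; apply: eq_bigr => b _; rewrite natrM.
rewrite rmorph_sum; apply: eq_bigr => v _ /=.
by rewrite rmorphM /= -pmulrn mulrz_nat.
Qed.

End Cones.

(** * Topological preliminaries *)
Section Topology.

(** A continuous injection of a compact set in a Hausdorff space is a closed map. *)
Lemma compact_homeomorphism (X Y : topologicalType) (x0 : X) (A : set X) (f : X -> Y) :
  hausdorff_space Y -> compact A -> {within A, continuous f} ->
  {in A &, injective f} -> homeomorphism A (f @` A) f.
Proof.
move=> hY cA cf fi.
have /choice[g gP] : forall y, exists x, (f @` A) y -> A x /\ f x = y.
  move=> y; case: (pselect ((f @` A) y)) => [[x Ax <-]|ny]; first by exists x.
  by exists x0.
have gf x : A x -> g (f x) = x.
  move=> Ax; have [|Ag e] := gP (f x); first by exists x.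
  by apply: fi; rewrite ?inE.
split; first split.
- by move=> x Ax; exists x.
- by move=> x y Ax Ay; exact: fi.
- by [].
- exact: cf.
exists g; split; first by move=> x; rewrite inE; exact: gf.
apply/continuous_closedP => C cC; apply/closed_subspaceP.
exists (f @` (A `&` C)).
  apply: compact_closed hY _; apply: continuous_compact.
    by apply: continuous_subspaceW cf; exact: subIsetl.
  exact: compact_closedI.
apply/seteqP; split=> y [].
  by move=> [x [Ax Cx] <-] fA; split=> //; change (C (g (f x))); rewrite gf.
move=> Cg [x Ax xy]; move: Cg; change (C (g y) -> (f @` (A `&` C) `&` f @` A) y).
by rewrite -xy gf // => Cx; split; exists x.
Qed.

Variables (R : realType) (n : nat).

Lemma cvg_row (T : Type) (F : set_system T) (FF : Filter F) (f : T -> 'rV[R]_n) (l : 'rV[R]_n) :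
  (forall j, f t 0 j @[t --> F] --> l 0 j) -> f t @[t --> F] --> l.
Proof.
move=> fl B [P lP PB].
have : \forall t \near F, forall j, P 0 j (f t 0 j).
  by apply: filter_forall => j; apply: fl; exact: lP.
by apply: filterS => t Pt; apply: PB => i j; rewrite (ord1 i).
Qed.

Lemma euclidean_norm_continuous : continuous (@euclidean_norm R n).
Proof.
move=> x; apply: (@cvg_comp _ _ _ (fun x : 'rV[R]_n => \sum_i x 0 i ^+ 2) Num.sqrt
  _ (nbhs (\sum_i x 0 i ^+ 2))); last exact: sqrt_continuous.
apply: (@cvg_big _ _ _ _ _ _ _ _ _ _ _ (nbhs_filter x)) => [|i _].
  exact: add_continuous.
by apply: cvgM; exact: coord_continuous.
Qed.

Definition normalize (x : 'rV[R]_n) : 'rV[R]_n := (euclidean_norm x)^-1 *: x.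

Lemma normalize_continuous x : euclidean_norm x != 0 -> {for x, continuous normalize}.
Proof.
move=> x0; apply: (cvg_row (nbhs_filter x)) => j; rewrite /normalize.
under eq_cvg do rewrite mxE.
rewrite mxE; apply: cvgM; last exact: coord_continuous.
by apply: cvgV => //; exact: euclidean_norm_continuous.
Qed.

Lemma euclidean_norm_ge0 (x : 'rV[R]_n) : 0 <= euclidean_norm x.
Proof. exact: sqrtr_ge0. Qed.

Lemma euclidean_norm_eq0 (x : 'rV[R]_n) : (euclidean_norm x == 0) = (x == 0).
Proof.
have s0 : 0 <= \sum_i x 0 i ^+ 2 by apply: sumr_ge0 => i _; exact: sqr_ge0.
rewrite sqrtr_eq0 le_eqVlt ltNge s0 orbF psumr_eq0; last by move=> i _; exact: sqr_ge0.
apply/allP/eqP => [x0|-> i _]; last by rewrite /= mxE expr0n eqxx.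
by apply/rowP => i; have /= := x0 i (mem_index_enum _); rewrite sqrf_eq0 mxE => /eqP.
Qed.

Lemma euclidean_normZ c (x : 'rV[R]_n) : 0 <= c -> euclidean_norm (c *: x) = c *
    euclidean_norm x.
Proof.
move=> c0; rewrite /euclidean_norm.
under eq_bigr do rewrite mxE exprMn.
by rewrite -mulr_sumr sqrtrM ?sqr_ge0 // sqrtr_sqr ger0_norm.
Qed.

Lemma normalizeZ c (x : 'rV[R]_n) : 0 < c -> normalize (c *: x) = normalize x.
Proof.
move=> c0; rewrite /normalize euclidean_normZ ?(ltW c0) // scalerA; congr (_ *: _).
by rewrite invfM mulrAC mulVf ?mul1r // gt_eqF.
Qed.

Lemma normalize_sphere (x : 'rV[R]_n) : x != 0 -> unit_sphere R n (normalize x).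
Proof.
move=> x0; rewrite /unit_sphere /= euclidean_normZ ?invr_ge0 ?euclidean_norm_ge0 //.
by rewrite mulVf // euclidean_norm_eq0.
Qed.

(** Rational points are dense, and clearing denominators moves a rational point
    along its ray. *)
Lemma rational_directions_dense (y : 'rV[R]_n) (O : set 'rV[R]_n) : nbhs y O ->
  exists (N : R) (z : 'I_n -> int), 0 < N /\ O (N *: \row_i (z i)%:~R).
Proof.
move=> [P yP PO].
have /choice[r rP] : forall i, exists r : rat, P 0 i (ratr r).
  move=> i; have [||x [/interior_subset Px [r _ rx]]] := @dense_rat R (P 0 i)^°.
  - by exists (y 0 i); exact: yP.
  - exact: open_interior.
  - by exists r; rewrite rx.
have [N [z [N0 zE]]] := integer_multiple (\row_i r i).
exists (ratr N)^-1, z; split; first by rewrite invr_gt0 ltr0q.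
apply: PO => i j; rewrite !mxE (ord1 i).
have -> : (z j)%:~R = ratr N * ratr (r j) :> R.
  by have := zE j; rewrite mxE -rmorphM /= => <-; rewrite ratr_int.
by rewrite mulKf // fmorph_eq0 gt_eqF.
Qed.

End Topology.

(** * The homeomorphism *)
Section Realization.

Variables (R : realType) (n : nat) (Q : quiver n) (k : closedFieldType).
Hypothesis pos : tits_positive Q.
Variable roots : seq (dimvector n).
Hypothesis roots_uniq : uniq roots.
Hypothesis rootsP : forall beta, beta \in roots <-> schur_root k Q beta.

Local Notation vertices := (vertices roots).
Local Notation realize := (realize Q k roots).
Local Notation in_cone := (in_cone Q k).
Local Notation A := (@realization R _ (cluster_tilting_complex k Q)).

Lemma realizationP (t : cluster_vertex n -> R) :
  A t <-> in_cone t /\ \sum_(x <- vertices) t x = 1.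
Proof.
split=> [[s [_ sP] [t0 tge t1]]|[ct t1]].
  have ct : in_cone t by exists s.
  split=> //; rewrite -t1 -(fsum_vertices roots_uniq); last first.
    by move=> x; exact: in_cone_vertices ct.
  by symmetry; apply: fsbig_widen => // x [_ /t0].
have [s sP [t0 tge]] := ct; exists s; last first.
  split=> //; rewrite -t1 -(fsum_vertices roots_uniq); last first.
    by move=> x; exact: in_cone_vertices ct.
  by apply: fsbig_widen => // x [_ /t0].
split=> //; apply: contrapT => s0.
have z x : t x = 0 by apply: t0 => sx; apply: s0; exists x.
by have /eqP := t1; rewrite big1 // eq_sym oner_eq0.
Qed.

(** The complex is a flag complex: lying in a common simplex is a condition on
    pairs of vertices, and for a point [t] it becomes the family of closed
    conditions [t x * t y = 0]. *)
Definition incompatible (x y : cluster_vertex n) : Prop :=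
  match x, y with
  | Root b, Root b' => b <> b' /\ ext_dim k Q b b' <> 0%N
  | Root b, ShiftedProj v => b v <> 0%N
  | _, _ => False
  end.

Lemma realization_closed_conditions (t : cluster_vertex n -> R) :
  A t <-> [/\ forall x, (if x \in vertices then `[0, 1] else [set 0])%classic (t x),
              \sum_(x <- vertices) t x = 1 &
              forall x y, incompatible x y -> t x * t y = 0].
Proof.
rewrite realizationP; split=> [[ct t1]|[tV t1 ti]].
  have [s [_ sr se sp] [t0 tge]] := ct; split=> // [x|x y xy].
    case: ifPn => [xV|]; last exact: in_cone_vertices.
    rewrite /= in_itv /= tge -t1 (bigD1_seq x) ?vertices_uniq //= lerDl.
    exact: sumr_ge0.
  have [sx|/t0 ->] := pselect (s x); last by rewrite mul0r.
  have [sy|/t0 ->] := pselect (s y); last by rewrite mulr0.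
  case: x y xy sx sy => [b|v] [b'|v'] //=.
    by move=> [bb' e] sb sb'; case: e; exact: se.
  by move=> e sb sv; case: e; exact: sp.
split=> //; exists [set x | t x != 0]; last first.
  split=> [x /negP/negPn/eqP//|x].
  by have := tV x; case: ifP => _ /=; [rewrite in_itv => /andP[]|move=> ->].
have supp x : t x != 0 -> x \in vertices.
  by have := tV x; case: ifP => //= _ ->; rewrite eqxx.
split.
- by apply: (@sub_finite_set _ _ [set` vertices]) => //; exact: finite_seq.
- by move=> b /= /supp; rewrite mem_vertices => /rootsP.
- move=> b b' /= tb tb' bb'; apply: contrapT => e.
  have /eqP := ti (Root b) (Root b') (conj bb' e).
  by rewrite mulf_eq0 (negPf tb) (negPf tb').
- move=> b v /= tb tv; apply: contrapT => e.
  have /eqP := ti (Root b) (ShiftedProj v) e.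
  by rewrite mulf_eq0 (negPf tb) (negPf tv).
Qed.

Lemma eval_continuous (x : cluster_vertex n) :
  continuous (fun t : {ptws cluster_vertex n -> R} => t x).
Proof. exact: (@proj_continuous _ (fun=> R) x). Qed.

(** A closed subset of a product of segments and points. *)
Lemma realization_compact : compact A.
Proof.
pose box (x : cluster_vertex n) : set R := if x \in vertices then `[0, 1]%classic else [set 0].
pose B : set {ptws cluster_vertex n -> R} := [set t | forall x, box x (t x)].
pose C : set {ptws cluster_vertex n -> R} := [set t | \sum_(x <- vertices) t x = 1].
pose D (p : cluster_vertex n * cluster_vertex n) : set {ptws cluster_vertex n -> R} :=
  [set t | t p.1 * t p.2 = 0].
have cB : compact B.
  apply: (@tychonoff _ (fun=> R)) => x; rewrite /box; case: ifP => _.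
    exact: segment_compact.
  exact: compact_set1.
have cC : closed C.
  apply: (@preimage_closed _ _ (fun t : {ptws cluster_vertex n -> R} => \sum_(x <-
      vertices) t x) [set 1]).
    move=> t _; apply: (@cvg_big _ _ _ _ _ _ _ _ _ _ _ (nbhs_filter t)) => [|x _].
      exact: add_continuous.
    exact: eval_continuous.
  exact: closed_eq.
have cD p : closed (D p).
  apply: (@preimage_closed _ _ (fun t : {ptws cluster_vertex n -> R} => t p.1 * t p.2) [set 0]).
    move=> t _; exact: (@cvgM R _ (nbhs t) (nbhs_filter t) (fun u : {ptws cluster_vertex
        n -> R} => u p.1)
      (fun u : {ptws cluster_vertex n -> R} => u p.2) (t p.1) (t p.2)
      (@eval_continuous p.1 t) (@eval_continuous p.2 t)).
  exact: closed_eq.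
have -> : A = B `&` (C `&` \bigcap_(p in [set p | incompatible p.1 p.2]) D p).
  apply/seteqP; split=> t.
    move=> /realization_closed_conditions[tb t1 ti]; split; first exact: tb.
    by split; [exact: t1|move=> [x y] /= /ti].
  move=> [tb [t1 ti]]; apply/realization_closed_conditions; split; [exact: tb|exact: t1|].
  by move=> x y xy; exact: (ti (x, y)).
apply: (compact_closedI cB); apply: (closedI cC).
by apply: closed_bigI => p _; exact: cD.
Qed.

Lemma realize_continuous : continuous (realize : {ptws cluster_vertex n -> R} -> 'rV[R]_n).
Proof.
move=> t; apply: (cvg_row (nbhs_filter t)) => j; rewrite /realize summxE.
under eq_cvg do rewrite summxE.
apply: (@cvg_big _ _ _ _ _ _ _ _ _ _ _ (nbhs_filter t)) => [|x _].
  exact: add_continuous.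
under eq_cvg do rewrite mxE.
rewrite mxE; exact: (@cvgM R _ (nbhs t) (nbhs_filter t) (fun u : {ptws cluster_vertex n
    -> R} => u x)
  (fun=> vertex_vector R k Q x 0 j) (t x) (vertex_vector R k Q x 0 j)
  (@eval_continuous x t) (@cvg_cst _ _ _ _ (nbhs_filter t))).
Qed.

Lemma realizeZ c (t : cluster_vertex n -> R) :
  realize (fun x => c * t x) = c *: realize t.
Proof. by rewrite /realize scaler_sumr; apply: eq_bigr => x _; rewrite scalerA. Qed.

Lemma in_coneZ c (t : cluster_vertex n -> R) : 0 <= c -> in_cone t ->
  in_cone (fun x => c * t x).
Proof.
move=> c0 [s sP [t0 tge]]; exists s => //; split=> [x /t0 ->|x]; first by rewrite mulr0.
exact: mulr_ge0.
Qed.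

(** The apex of the cones is attained only with zero coefficients. *)
Lemma realize_neq0 (t : cluster_vertex n -> R) : A t -> realize t != 0.
Proof.
move=> /realizationP[ct t1]; apply/eqP => t0.
have /(realize_inj pos roots_uniq rootsP ct) z : in_cone (fun=> 0 : R).
  by exists set0 => //; split=> //; exact: finite_set0.
have /eqP := t1; rewrite big1 => [|x _]; first by rewrite eq_sym oner_eq0.
by apply: z; rewrite t0 /realize big1 // => y _; rewrite scale0r.
Qed.

Lemma lambda_realize (t : cluster_vertex n -> R) : A t ->
  cluster_lambda R k Q t = normalize (realize t).
Proof.
move=> /realizationP[ct _]; rewrite /cluster_lambda (fsum_vertices roots_uniq) //.
by move=> x xV; rewrite (in_cone_vertices rootsP ct xV) scale0r.
Qed.

Lemma lambda_continuous : {within A, continuous (cluster_lambda R k Q)}.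
Proof.
apply: (@subspace_eq_continuous _ A _ (fun t => normalize (realize t))).
  by move=> t; rewrite inE => At; exact: (esym (lambda_realize At)).
apply: continuous_in_subspaceT => t; rewrite inE => At.
apply: continuous_comp; first exact: realize_continuous.
by apply: normalize_continuous; rewrite euclidean_norm_eq0; exact: realize_neq0.
Qed.

(** Points on the same ray are proportional, by a factor equal to 1 since the
    coefficients sum to 1. *)
Lemma lambda_inj : {in A &, injective (cluster_lambda R k Q)}.
Proof.
move=> t t'; rewrite !inE => At At'; rewrite !lambda_realize // => e.
have [/realizationP[ct t1] /realizationP[ct' t1']] := (At, At').
have nz u : A u -> 0 < euclidean_norm (realize u).
  by move=> Au; rewrite lt_def euclidean_norm_ge0 andbT euclidean_norm_eq0 realize_neq0.
pose c := euclidean_norm (realize t) / euclidean_norm (realize t').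
have c0 : 0 < c by rewrite divr_gt0 ?nz.
have tE : forall x, t x = c * t' x.
  apply: (realize_inj pos roots_uniq rootsP ct (in_coneZ (ltW c0) ct')).
  rewrite realizeZ /c -scalerA -[_ *: realize t']/(normalize (realize t')) -e.
  by rewrite scalerA mulfV ?scale1r // gt_eqF ?nz.
have c1 : c = 1.
  by rewrite -t1 (eq_bigr _ (fun x _ => tE x)) -mulr_sumr t1' mulr1.
by apply/funext => x; rewrite tE c1 mul1r.
Qed.

(** A point of the sphere outside the closed image would have a neighbourhood
    outside it, which contains a direction with integral coordinates. *)
Lemma lambda_image : cluster_lambda R k Q @` A = unit_sphere R n.
Proof.
apply/seteqP; split=> [_ [t At <-]|y y1].
  by rewrite lambda_realize //; exact/normalize_sphere/realize_neq0.
have cl : closed (cluster_lambda R k Q @` A).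
  apply: compact_closed; first exact: norm_hausdorff.
  exact: continuous_compact lambda_continuous realization_compact.
apply: contrapT => ny.
have ey : euclidean_norm y != 0 by rewrite y1 oner_neq0.
have ly : normalize y = y by rewrite /normalize y1 invr1 scale1r.
have nb : nbhs y (@normalize R n @^-1` (~` (cluster_lambda R k Q @` A))).
  apply: (normalize_continuous ey); rewrite ly.
  by apply: open_nbhs_nbhs; split=> //; exact: closed_openC.
have nb0 : nbhs y [set x | x != 0].
  have /cvgr_neq0 := @euclidean_norm_continuous R n y.
  by move=> /(_ ey); apply: filterS => x /=; rewrite euclidean_norm_eq0.
have [N [z [N0 [zl z0]]]] := rational_directions_dense (filterI nb nb0).
apply: zl; rewrite /= normalizeZ //.
have [t ct tz] := realize_integral R pos roots_uniq rootsP z.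
pose T := \sum_(x <- vertices) t x.
have tge x : 0 <= t x by case: ct => s _ [_ ].
have T0 : 0 < T.
  rewrite lt_def sumr_ge0 // andbT; apply: contraNneq z0 => T0.
  rewrite -tz /realize big_seq big1 ?scaler0 // => x xV.
  move/eqP: T0; rewrite /T psumr_eq0 // => /allP/(_ x xV)/eqP ->.
  by rewrite scale0r.
have At : A (fun x => T^-1 * t x).
  apply/realizationP; split; first by apply: in_coneZ => //; rewrite invr_ge0 ltW.
  by rewrite -mulr_sumr mulVf // gt_eqF.
exists (fun x => T^-1 * t x) => //.
by rewrite lambda_realize // realizeZ normalizeZ ?invr_gt0 // tz.
Qed.

End Realization.

Unset Implicit Arguments.
Set Strict Implicit.
Set Printing Implicit Defensive.

Theorem theorem8p1p2 (R : realType) (k : closedFieldType) (n : nat)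
  (Q : quiver n) (hQ : dynkin_quiver Q) :
  homeomorphic (realization R (cluster_tilting_complex k Q))
               (unit_sphere R n) /\
  homeomorphism (realization R (cluster_tilting_complex k Q))
                (unit_sphere R n)
                (cluster_lambda R k Q).
Proof.
suff h : homeomorphism (realization R (cluster_tilting_complex k Q))
    (unit_sphere R n) (cluster_lambda R k Q).
  by split=> //; exists (cluster_lambda R k Q).
have pos := dynkin_positive hQ.
have /finite_seqP[s sE] := finite_schur_roots pos k.
have rootsP beta : beta \in undup s <-> schur_root k Q beta.
  by rewrite mem_undup -[schur_root k Q beta]/((schur_root k Q : set _) beta) sE.
rewrite -(lambda_image R pos (undup_uniq s) rootsP).
apply: compact_homeomorphism.
- exact: (fun=> 0).
- exact: norm_hausdorff.
- exact: realization_compact (undup_uniq s) rootsP.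
- exact: (@lambda_continuous R n Q k pos (undup s) (undup_uniq s) rootsP).
- exact: (@lambda_inj R n Q k pos _ (undup_uniq s) rootsP).
Qed.
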